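(* Let $\mathcal{T}$ be an LTC-theory over a linear-time vocabulary $\Sigma$ and let $\varphi$ be a universal single-state sentence with time variable $t$. If $\mathcal{T}_0\models te(\varphi)$ and $\mathcal{T}_t\wedge te(\varphi)\models te(\varphi[\mathcal{S}(t)/t])$, then $\mathcal{T}\models\varphi$.
   Context: Linear-time vocabulary: a many-typed first-order vocabulary $\Sigma$ with a type $\mathrm{Time}$, a constant $\mathcal{I}$ of type $\mathrm{Time}$ and a function $\mathcal{S}(\mathrm{Time}):\mathrm{Time}$; every other symbol has at most one argument of type $\mathrm{Time}$ (written last), and no function other than $\mathcal{I},\mathcal{S}$ has output type $\mathrm{Time}$. In all $\Sigma$-structures $\mathrm{Time}$ is $\mathbb{N}$, $\mathcal{I}$ is $0$, $\mathcal{S}$ is successor. Other symbols are static (no $\mathrm{Time}$ argument) or dynamic. The single-state vocabulary $\Sigma_{ss}$ has the static symbols plus, for each dynamic $\sigma$, a symbol $\sigma^{\circ}$ with the $\mathrm{Time}$ argument removed; the bistate vocabulary $\Sigma_{bs}$ extends $\Sigma_{ss}$ with a further symbol $\sigma^{+}$ of the same signature as $\sigma^{\circ}$. Theories are FO(ID) theories: first-order sentences plus one definition (rules $\forall\bar x: P(\bar t)\leftarrow\varphi$ or $\forall\bar x:f(\bar t)=t'\leftarrow\varphi$, under the well-founded semantics). A sentence or rule is static if it has no $\mathrm{Time}$-terms; initial if its only $\mathrm{Time}$-term is $\mathcal{I}$; single-state if it contains a $\mathrm{Time}$ variable and no other $\mathrm{Time}$-terms; bistate if it contains a $\mathrm{Time}$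 variable $t$ and all its $\mathrm{Time}$-terms are $t$ or $\mathcal{S}(t)$; universal if of the form $\forall t:\varphi'$ with $t$ its unique $\mathrm{Time}$ variable, not requantified in $\varphi'$. An LTC-theory is one in which every sentence and rule is static, initial, universal single-state or universal bistate, and whose definition is stratified over time. $\varphi[b/a]$ denotes replacing the term $a$ by $b$. Time-elimination $te(\varphi)$ of a universal single-state or bistate $\varphi$ with time variable $t$: drop $\forall t$; replace each $\sigma(\dots,\mathcal{S}(t))$ by $\sigma^{+}(\dots)$ and each $\sigma(\dots,t)$ by $\sigma^{\circ}(\dots)$ for dynamic $\sigma$. The initial theory $\mathcal{T}_0$ (over $\Sigma_{ss}$) consists of the static sentences/rules of $\mathcal{T}$, $te(\forall t:\psi[t/\mathcal{I}])$ for each initial $\psi$, and $te(\psi)$ for each single-state $\psi$; the transition theory $\mathcal{T}_t$ (over $\Sigma_{bs}$) consists of the static sentences/rules of $\mathcal{T}$, $te(\psi)$ and $te(\psi[\mathcal{S}(t)/t])$ for each single-state $\psi$, and $te(\psi)$ for each bistate $\psi$. Entailment $\models$ is with respect to structures of the respective vocabularies.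
   Formalization: ''Stratified over time'' also requires that no symbol mixes rule kinds: its rules are all static, all single-state, or all initial/with head time S(t); without this the claim fails, e.g. for P(t)←Q(t) together with P(S(t))←R(t). *)

(* Defs.v *)
(* Many-typed first-order logic with inductive definitions, FO(ID), and
   linear-time theories. Syntax is intrinsically typed, with de Bruijn
   variables: the context of a formula lists the types of its free variables,
   the innermost one first. *)
From Stdlib Require Import List.
Import ListNotations.

Set Implicit Arguments.
Unset Strict Implicit.

Record vocabulary : Type := Vocabulary {
  ty : Type;
  fsym : Type;
  fargs : fsym -> list ty;
  fres : fsym -> ty;
  psym : Type;
  pargs : psym -> list ty }.

Inductive var (A : Type) : list A -> A -> Type :=
| VZ : forall (G : list A) (s : A), var (s :: G) s
| VS : forall (G : list A) (s s' : A), var G s -> var (s' :: G) s.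
Arguments VZ {A G s}.
Arguments VS {A G s s'} x.

Fixpoint hlist (A : Type) (F : A -> Type) (l : list A) : Type :=
  match l with
  | [] => unit
  | a :: l' => (F a * hlist F l')%type
  end.

Fixpoint hget (A : Type) (F : A -> Type) (G : list A) (s : A) (x : var G s) :
    hlist F G -> F s :=
  match x in var G0 s0 return hlist F G0 -> F s0 with
  | VZ => fun e => fst e
  | VS y => fun e => hget y (snd e)
  end.

Inductive term (V : vocabulary) (G : list (ty V)) : ty V -> Type :=
| Var : forall s : ty V, var G s -> term G s
| App : forall f : fsym V, terms G (fargs f) -> term G (fres f)
with terms (V : vocabulary) (G : list (ty V)) : list (ty V) -> Type :=
| tnil : terms G []
| tcons : forall (s : ty V) (l : list (ty V)),
    term G s -> terms G l -> terms G (s :: l).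
Arguments Var {V G s} x.
Arguments App {V G} f args.
Arguments tnil {V G}.
Arguments tcons {V G s l} a args.

Inductive formula (V : vocabulary) : list (ty V) -> Type :=
| Top : forall G, formula G
| Bot : forall G, formula G
| Atom : forall G (p : psym V), terms G (pargs p) -> formula G
| Eq : forall G (s : ty V), term G s -> term G s -> formula G
| Not : forall G, formula G -> formula G
| And : forall G, formula G -> formula G -> formula G
| Or : forall G, formula G -> formula G -> formula G
| All : forall G (s : ty V), formula (s :: G) -> formula G
| Ex : forall G (s : ty V), formula (s :: G) -> formula G.
Arguments Top {V G}.
Arguments Bot {V G}.
Arguments Atom {V G} p args.
Arguments All {V G} s phi.
Arguments Ex {V G} s phi.

Definition sentence (V : vocabulary) : Type := formula (V := V) [].

(* The heads P(args) and f(args) = v. *)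
Inductive head (V : vocabulary) (G : list (ty V)) : Type :=
| HPred : forall p : psym V, terms G (pargs p) -> head G
| HFun : forall f : fsym V, terms G (fargs f) -> term G (fres f) -> head G.
Arguments HPred {V G} p args.
Arguments HFun {V G} f args v.

(* [rctx] lists the types of the universally quantified variables. *)
Record rule (V : vocabulary) : Type := Rule {
  rctx : list (ty V);
  rhead : head rctx;
  rbody : formula rctx }.

Definition hsym (V : vocabulary) (G : list (ty V)) (h : head G) :
    psym V + fsym V :=
  match h with
  | HPred p _ => inl p
  | HFun f _ _ => inr f
  end.

Record theory (V : vocabulary) : Type := Theory {
  sentences : sentence V -> Prop;
  definition : rule V -> Prop }.

Definition add_sentence (V : vocabulary) (T : theory V) (phi : sentence V) :
    theory V :=
  {| sentences := fun psi => sentences T psi \/ psi = phi;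
     definition := definition T |}.

Record structure (V : vocabulary) : Type := Structure {
  dom : ty V -> Type;
  dom_inhabited : forall s : ty V, inhabited (dom s);
  fint : forall f : fsym V, hlist dom (fargs f) -> dom (fres f);
  pint : forall p : psym V, hlist dom (pargs p) -> Prop }.

Section Semantics.

Context (V : vocabulary) (A : structure V).

Fixpoint eval (G : list (ty V)) (e : hlist (dom A) G) (s : ty V)
    (a : term G s) {struct a} : dom A s :=
  match a in term _ s0 return dom A s0 with
  | Var x => hget x e
  | App f args => fint (evals e args)
  end
with evals (G : list (ty V)) (e : hlist (dom A) G) (l : list (ty V))
    (args : terms G l) {struct args} : hlist (dom A) l :=
  match args in terms _ l0 return hlist (dom A) l0 with
  | tnil => tt
  | tcons a args' => (eval e a, evals e args')
  end.

Fixpoint sat (G : list (ty V)) (phi : formula G) : hlist (dom A) G -> Prop :=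
  match phi in formula G0 return hlist (dom A) G0 -> Prop with
  | Top => fun _ => True
  | Bot => fun _ => False
  | Atom p args => fun e => pint (evals e args)
  | Eq a b => fun e => eval e a = eval e b
  | Not f => fun e => ~ sat f e
  | And f g => fun e => sat f e /\ sat g e
  | Or f g => fun e => sat f e \/ sat g e
  | All s f => fun e => forall d : dom A s, sat f (d, e)
  | Ex s f => fun e => exists d : dom A s, sat f (d, e)
  end.

(* Functions enter definitions through their graphs: a domain atom is
   P(ds) or f(ds) = d with ds, d domain elements. *)
Inductive datom : Type :=
| DPred : forall p : psym V, hlist (dom A) (pargs p) -> datom
| DFun : forall f : fsym V, hlist (dom A) (fargs f) -> dom A (fres f) -> datom.

Definition holds (a : datom) : Prop :=
  match a with
  | DPred ds => pint ds
  | DFun ds d => fint ds = d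
  end.

Definition dsym (a : datom) : psym V + fsym V :=
  match a with
  | @DPred p _ => inl p
  | @DFun f _ _ => inr f
  end.

Fixpoint den (K : datom -> Prop) (G : list (ty V)) (e : hlist (dom A) G)
    (s : ty V) (a : term G s) {struct a} : dom A s -> Prop :=
  match a in term _ s0 return dom A s0 -> Prop with
  | Var x => fun d => hget x e = d
  | App f args => fun d => exists ds, dens K e args ds /\ K (DFun ds d)
  end
with dens (K : datom -> Prop) (G : list (ty V)) (e : hlist (dom A) G)
    (l : list (ty V)) (args : terms G l) {struct args} :
    hlist (dom A) l -> Prop :=
  match args in terms _ l0 return hlist (dom A) l0 -> Prop with
  | tnil => fun _ => True
  | tcons a args' => fun ds => den K e a (fst ds) /\ dens K e args' (snd ds)
  end.

(* Kleene truth in the three-valued interpretation in which the atoms of L are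
   true and those outside U are false, nested terms being unfolded
   existentially: P(f(x)) is read as exists y, f(x) = y /\ P(y). *)
Fixpoint ktrue (L U : datom -> Prop) (G : list (ty V)) (phi : formula G) :
    hlist (dom A) G -> Prop :=
  match phi in formula G0 return hlist (dom A) G0 -> Prop with
  | Top => fun _ => True
  | Bot => fun _ => False
  | Atom p args => fun e => exists ds, dens L e args ds /\ L (@DPred p ds)
  | Eq a b => fun e => exists d, den L e a d /\ den L e b d
  | Not f => fun e => ~ ktrue U L f e
  | And f g => fun e => ktrue L U f e /\ ktrue L U g e
  | Or f g => fun e => ktrue L U f e \/ ktrue L U g e
  | All s f => fun e => forall d : dom A s, ktrue L U f (d, e)
  | Ex s f => fun e => exists d : dom A s, ktrue L U f (d, e)
  end.

Context (Delta : rule V -> Prop).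

Definition defined (q : psym V + fsym V) : Prop :=
  exists r, Delta r /\ hsym (rhead r) = q.

(* The open symbols of Delta are interpreted by A. *)
Definition with_open (X : datom -> Prop) (a : datom) : Prop :=
  (defined (dsym a) /\ X a) \/ (~ defined (dsym a) /\ holds a).

Definition head_instance (K : datom -> Prop) (G : list (ty V)) (h : head G)
    (e : hlist (dom A) G) (a : datom) : Prop :=
  match h with
  | HPred p args => exists ds, dens K e args ds /\ a = @DPred p ds
  | HFun f args v =>
      exists ds d, dens K e args ds /\ den K e v d /\ a = @DFun f ds d
  end.

Definition derives (L U : datom -> Prop) (a : datom) : Prop :=
  exists r, Delta r /\ exists e : hlist (dom A) (rctx r),
    head_instance (with_open L) (rhead r) e a /\
    ktrue (with_open L) (with_open U) (rbody r) e.

(* Alternating fixpoint construction of the well-founded model: [stable U] is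
   the least fixpoint of [fun X => derives X U], which is antitone in U;
   [wf_true] is the least fixpoint of its square; the atoms outside
   [wf_possible] are the false ones. *)
Definition stable (U : datom -> Prop) (a : datom) : Prop :=
  forall X : datom -> Prop, (forall b, derives X U b -> X b) -> X a.

Definition wf_true (a : datom) : Prop :=
  forall X : datom -> Prop, (forall b, stable (stable X) b -> X b) -> X a.

Definition wf_possible : datom -> Prop := stable wf_true.

(* A is the (two-valued) well-founded model of Delta over its own
   interpretation of the open symbols. *)
Definition sat_definition : Prop :=
  forall a : datom, defined (dsym a) ->
    (wf_true a <-> holds a) /\ (wf_possible a <-> holds a).

End Semantics.

Definition sat_sentence (V : vocabulary) (A : structure V) (phi : sentence V) :
    Prop :=
  sat (A := A) phi tt.

Definition sat_theory (V : vocabulary) (A : structure V) (T : theory V) : Prop :=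
  (forall psi, sentences T psi -> sat_sentence A psi) /\
  sat_definition A (definition T).

Definition entails (V : vocabulary) (T : theory V) (phi : sentence V) : Prop :=
  forall A : structure V, sat_theory A T -> sat_sentence A phi.

(* A linear-time vocabulary, presented by its types other than Time and its
   symbols other than the two Time functions. The argument lists omit the
   last, Time-typed, argument of the dynamic symbols. *)
Record lt_vocabulary : Type := LtVocabulary {
  sort : Type;
  sfun : Type;
  sfun_args : sfun -> list sort;
  sfun_res : sfun -> sort;
  dfun : Type;
  dfun_args : dfun -> list sort;
  dfun_res : dfun -> sort;
  spred : Type;
  spred_args : spred -> list sort;
  dpred : Type;
  dpred_args : dpred -> list sort }.

Inductive lt_fsym (S : lt_vocabulary) : Type :=
| FInit : lt_fsym S
| FSucc : lt_fsym S
| FStat : sfun S -> lt_fsym S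
| FDyn : dfun S -> lt_fsym S.
Arguments FInit {S}.
Arguments FSucc {S}.

Inductive lt_psym (S : lt_vocabulary) : Type :=
| PStat : spred S -> lt_psym S
| PDyn : dpred S -> lt_psym S.

(* Among the types [option (sort S)], [None] is Time. *)
Definition static_args (B : Type) (l : list B) : list (option B) := map Some l.
Definition dynamic_args (B : Type) (l : list B) : list (option B) :=
  map Some l ++ [None].

Definition lt_fargs (S : lt_vocabulary) (f : lt_fsym S) :
    list (option (sort S)) :=
  match f with
  | FInit => []
  | FSucc => [None]
  | FStat g => static_args (sfun_args g)
  | FDyn g => dynamic_args (dfun_args g)
  end.

Definition lt_fres (S : lt_vocabulary) (f : lt_fsym S) : option (sort S) :=
  match f with
  | FInit => None
  | FSucc => None
  | FStat g => Some (sfun_res g)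
  | FDyn g => Some (dfun_res g)
  end.

Definition lt_pargs (S : lt_vocabulary) (p : lt_psym S) :
    list (option (sort S)) :=
  match p with
  | PStat q => static_args (spred_args q)
  | PDyn q => dynamic_args (dpred_args q)
  end.

Definition lt_voc (S : lt_vocabulary) : vocabulary :=
  {| ty := option (sort S);
     fsym := lt_fsym S;
     fargs := @lt_fargs S;
     fres := @lt_fres S;
     psym := lt_psym S;
     pargs := @lt_pargs S |}.

Definition lt_dom (B : Type) (D : B -> Type) (s : option B) : Type :=
  match s with
  | None => nat
  | Some s' => D s'
  end.

Record lt_structure (S : lt_vocabulary) : Type := LtStructure {
  ldom : sort S -> Type;
  ldom_inhabited : forall s : sort S, inhabited (ldom s);
  sfun_int : forall f : sfun S,
    hlist (lt_dom ldom) (static_args (sfun_args f)) -> ldom (sfun_res f);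
  dfun_int : forall f : dfun S,
    hlist (lt_dom ldom) (dynamic_args (dfun_args f)) -> ldom (dfun_res f);
  spred_int : forall p : spred S,
    hlist (lt_dom ldom) (static_args (spred_args p)) -> Prop;
  dpred_int : forall p : dpred S,
    hlist (lt_dom ldom) (dynamic_args (dpred_args p)) -> Prop }.

Section LinearTime.

Context (S : lt_vocabulary).

Local Notation V := (lt_voc S).

Definition lt_dom_inhabited (J : lt_structure S) (s : option (sort S)) :
    inhabited (lt_dom (@ldom S J) s) :=
  match s with
  | None => inhabits 0
  | Some s' => ldom_inhabited J s'
  end.

Definition lt_fint (J : lt_structure S) (f : lt_fsym S) :
    hlist (lt_dom (@ldom S J)) (lt_fargs f) -> lt_dom (@ldom S J) (lt_fres f) :=
  match f return
    hlist (lt_dom (@ldom S J)) (lt_fargs f) -> lt_dom (@ldom S J) (lt_fres f)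
  with
  | FInit => fun _ => 0
  | FSucc => fun ds => Datatypes.S (fst ds)
  | FStat g => fun ds => @sfun_int S J g ds
  | FDyn g => fun ds => @dfun_int S J g ds
  end.

Definition lt_pint (J : lt_structure S) (p : lt_psym S) :
    hlist (lt_dom (@ldom S J)) (lt_pargs p) -> Prop :=
  match p return hlist (lt_dom (@ldom S J)) (lt_pargs p) -> Prop with
  | PStat q => fun ds => @spred_int S J q ds
  | PDyn q => fun ds => @dpred_int S J q ds
  end.

Definition lt_str (J : lt_structure S) : structure V :=
  {| dom := (lt_dom (@ldom S J) : ty V -> Type);
     dom_inhabited := lt_dom_inhabited J;
     fint := (@lt_fint J : forall f : fsym V, _);
     pint := (@lt_pint J : forall p : psym V, _) |}.

Definition lt_entails (T : theory V) (phi : sentence V) : Prop :=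
  forall J : lt_structure S,
    sat_theory (lt_str J) T -> sat_sentence (lt_str J) phi.

Definition time_term (G : list (ty V)) : Type := term (V := V) G None.

Definition is_init (G : list (ty V)) (a : time_term G) : Prop :=
  match a with
  | App FInit _ => True
  | _ => False
  end.

Definition is_tvar (G : list (ty V)) (s : ty V) (a : term G s) : Prop :=
  match a with
  | Var _ => True
  | App _ _ => False
  end.

Definition is_succ_tvar (G : list (ty V)) (a : time_term G) : Prop :=
  match a with
  | Var _ => False
  | App f args =>
      match f return terms (V := V) G (fargs (v := V) f) -> Prop with
      | FSucc => fun args0 =>
          match args0 with
          | tnil => False
          | tcons b _ => is_tvar b
          end
      | _ => fun _ => False
      end args
  end.

Definition is_no_term (G : list (ty V)) (a : time_term G) : Prop := False.
Definition is_t (G : list (ty V)) (a : time_term G) : Prop := is_tvar a.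
Definition is_t_or_succ_t (G : list (ty V)) (a : time_term G) : Prop :=
  is_tvar a \/ is_succ_tvar a.

Section TimeTerms.

Context (Q : forall G : list (ty V), time_term G -> Prop).

Definition check_time (G : list (ty V)) (s : ty V) : term G s -> Prop :=
  match s return term (V := V) G s -> Prop with
  | None => fun a => @Q G a
  | Some _ => fun _ => True
  end.

Fixpoint ttm (G : list (ty V)) (s : ty V) (a : term G s) {struct a} : Prop :=
  check_time a /\
  match a with
  | Var _ => True
  | App _ args => ttms args
  end
with ttms (G : list (ty V)) (l : list (ty V)) (args : terms G l) {struct args} :
    Prop :=
  match args with
  | tnil => True
  | tcons a args' => ttm a /\ ttms args'
  end.

(* All Time-terms satisfy Q, and no quantifier ranges over Time. *)
Fixpoint time_terms (G : list (ty V)) (phi : formula G) : Prop :=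
  match phi with
  | Top => True
  | Bot => True
  | Atom _ args => ttms args
  | Eq a b => ttm a /\ ttm b
  | Not f => time_terms f
  | And f g => time_terms f /\ time_terms g
  | Or f g => time_terms f /\ time_terms g
  | All s f => s <> None /\ time_terms f
  | Ex s f => s <> None /\ time_terms f
  end.

Definition time_terms_head (G : list (ty V)) (h : head G) : Prop :=
  match h with
  | HPred _ args => ttms args
  | HFun _ args v => ttms args /\ ttm v
  end.

Definition time_terms_rule (r : rule V) : Prop :=
  time_terms_head (rhead r) /\ time_terms (rbody r).

End TimeTerms.

Definition static_sentence (psi : sentence V) : Prop :=
  time_terms is_no_term psi.
Definition initial_sentence (psi : sentence V) : Prop :=
  time_terms is_init psi /\ ~ static_sentence psi.
(* Inner quantifiers over Time being excluded, every Time variable of phi is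
   the outermost one. *)
Definition universal_single_state (psi : sentence V) : Prop :=
  exists phi : formula (V := V) [None],
    psi = All (None : ty V) phi /\ time_terms is_t phi.
Definition universal_bistate (psi : sentence V) : Prop :=
  exists phi : formula (V := V) [None],
    psi = All (None : ty V) phi /\ time_terms is_t_or_succ_t phi.

Fixpoint count_time (G : list (option (sort S))) : nat :=
  match G with
  | [] => 0
  | None :: G' => Datatypes.S (count_time G')
  | Some _ :: G' => count_time G'
  end.

Definition static_rule (r : rule V) : Prop :=
  count_time (rctx r) = 0 /\ time_terms_rule is_no_term r.
Definition initial_rule (r : rule V) : Prop :=
  count_time (rctx r) = 0 /\ time_terms_rule is_init r /\ ~ static_rule r.
Definition single_state_rule (r : rule V) : Prop :=
  count_time (rctx r) = 1 /\ time_terms_rule is_t r.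
Definition bistate_rule (r : rule V) : Prop :=
  count_time (rctx r) = 1 /\ time_terms_rule is_t_or_succ_t r.

Definition terms_hd (G : list (ty V)) (s : ty V) (l : list (ty V))
    (args : terms G (s :: l)) : term G s :=
  match args in terms _ l0
    return match l0 with [] => unit | s0 :: _ => term G s0 end
  with
  | tnil => tt
  | tcons a _ => a
  end.

Definition terms_tl (G : list (ty V)) (s : ty V) (l : list (ty V))
    (args : terms G (s :: l)) : terms G l :=
  match args in terms _ l0
    return match l0 with [] => unit | _ :: l1 => terms G l1 end
  with
  | tnil => tt
  | tcons _ args' => args'
  end.

Fixpoint time_arg (G : list (ty V)) (l : list (sort S)) :
    terms (V := V) G (dynamic_args l) -> time_term G :=
  match l return terms (V := V) G (dynamic_args l) -> time_term G with
  | [] => fun args => terms_hd args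
  | _ :: _ => fun args => time_arg (terms_tl args)
  end.

(* The Time argument of the head symbol, if it has one. *)
Definition head_time (G : list (ty V)) (h : head G) : option (time_term G) :=
  match h with
  | HPred p args =>
      match p return terms (V := V) G (pargs (v := V) p) -> _ with
      | PStat _ => fun _ => None
      | PDyn _ => fun args0 => Some (time_arg args0)
      end args
  | HFun f args _ =>
      match f return terms (V := V) G (fargs (v := V) f) -> _ with
      | FDyn _ => fun args0 => Some (time_arg args0)
      | _ => fun _ => None
      end args
  end.

Definition head_at_t (r : rule V) : Prop :=
  exists a, head_time (rhead r) = Some a /\ is_tvar a.

(* Zero and successor have a fixed interpretation and are not definable. *)
Definition defines_lt_symbol (r : rule V) : Prop :=
  hsym (rhead r) <> inr (FInit : fsym V) /\
  hsym (rhead r) <> inr (FSucc : fsym V).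

(* No atom is defined in terms of later ones, static symbols being available
   from time 0 on: their rules mention no time point, or only I; rules with
   time point t in the head do not mention S(t). Moreover a symbol is defined
   either pointwise, by static rules (if static) or single-state rules (if
   dynamic), or else by initial rules and, if dynamic, rules with head time
   S(t). Without this last clause the transition theory would not contain, for
   the symbols it defines in the current state, all their rules at that time
   point: with P(t) <- Q(t) and P(S(t)) <- R(t), its rule for the current-state
   copy of P would force P to agree with Q there. *)
Definition stratified_over_time (Delta : rule V -> Prop) : Prop :=
  (forall r, Delta r -> head_time (rhead r) = None ->
     static_rule r \/ initial_rule r) /\
  (forall r, Delta r -> head_at_t r -> single_state_rule r) /\
  (forall r r', Delta r -> Delta r' -> hsym (rhead r) = hsym (rhead r') ->
     (static_rule r -> static_rule r') /\ (head_at_t r -> head_at_t r')).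

Definition ltc_theory (T : theory V) : Prop :=
  (forall psi, sentences T psi ->
     static_sentence psi \/ initial_sentence psi \/
     universal_single_state psi \/ universal_bistate psi) /\
  (forall r, definition T r ->
     static_rule r \/ initial_rule r \/ single_state_rule r \/ bistate_rule r) /\
  (forall r, definition T r -> defines_lt_symbol r) /\
  stratified_over_time (definition T).

Definition succ_term (G : list (ty V)) (a : time_term G) : time_term G :=
  App (V := V) (FSucc : fsym V) (tcons a tnil).

(* The replacement [S(t)/t]. *)
Fixpoint succ_tm (G : list (ty V)) (s : ty V) (a : term G s) {struct a} :
    term G s :=
  match a in term _ s0 return term G s0 with
  | @Var _ _ s0 x =>
      match s0 return var G s0 -> term (V := V) G s0 with
      | None => fun x0 => succ_term (Var x0)
      | Some _ => fun x0 => Var x0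
      end x
  | App f args => App f (succ_tms args)
  end
with succ_tms (G : list (ty V)) (l : list (ty V)) (args : terms G l)
    {struct args} : terms G l :=
  match args in terms _ l0 return terms G l0 with
  | tnil => tnil
  | tcons a args' => tcons (succ_tm a) (succ_tms args')
  end.

Fixpoint succ_formula (G : list (ty V)) (phi : formula G) : formula G :=
  match phi in formula G0 return formula G0 with
  | Top => Top
  | Bot => Bot
  | Atom p args => Atom p (succ_tms args)
  | Eq a b => Eq (succ_tm a) (succ_tm b)
  | Not f => Not (succ_formula f)
  | And f g => And (succ_formula f) (succ_formula g)
  | Or f g => Or (succ_formula f) (succ_formula g)
  | All s f => All s (succ_formula f)
  | Ex s f => Ex s (succ_formula f)
  end.

Definition succ_head (G : list (ty V)) (h : head G) : head G :=
  match h with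
  | HPred p args => HPred p (succ_tms args)
  | HFun f args v => HFun f (succ_tms args) (succ_tm v)
  end.

Definition succ_rule (r : rule V) : rule V :=
  {| rctx := rctx r;
     rhead := succ_head (rhead r);
     rbody := succ_formula (rbody r) |}.

Fixpoint var_app (B : Type) (G : list B) (s : B) (x : var G s) (G' : list B) :
    var (G ++ G') s :=
  match x in var G0 s0 return var (G0 ++ G') s0 with
  | VZ => VZ
  | VS y => VS (var_app y G')
  end.

Fixpoint var_last (B : Type) (G : list B) (s : B) : var (G ++ [s]) s :=
  match G return var (G ++ [s]) s with
  | [] => VZ
  | _ :: G' => VS (var_last G' s)
  end.

(* The replacement [t/I], with t a fresh outermost variable. *)
Fixpoint uninit_tm (G : list (ty V)) (s : ty V) (a : term G s) {struct a} :
    term (V := V) (G ++ [None]) s :=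
  match a in term _ s0 return term (V := V) (G ++ [None]) s0 with
  | Var x => Var (var_app x [None])
  | App f args =>
      match f return
        terms (V := V) (G ++ [None]) (fargs (v := V) f) ->
        term (V := V) (G ++ [None]) (fres (v := V) f)
      with
      | FInit => fun _ => Var (var_last G None)
      | f0 => fun args0 => App (V := V) (f0 : fsym V) args0
      end (uninit_tms args)
  end
with uninit_tms (G : list (ty V)) (l : list (ty V)) (args : terms G l)
    {struct args} : terms (V := V) (G ++ [None]) l :=
  match args in terms _ l0 return terms (V := V) (G ++ [None]) l0 with
  | tnil => tnil
  | tcons a args' => tcons (uninit_tm a) (uninit_tms args')
  end.

Fixpoint uninit_formula (G : list (ty V)) (phi : formula G) :
    formula (V := V) (G ++ [None]) :=
  match phi in formula G0 return formula (V := V) (G0 ++ [None]) with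
  | Top => Top
  | Bot => Bot
  | Atom p args => Atom p (uninit_tms args)
  | Eq a b => Eq (uninit_tm a) (uninit_tm b)
  | Not f => Not (uninit_formula f)
  | And f g => And (uninit_formula f) (uninit_formula g)
  | Or f g => Or (uninit_formula f) (uninit_formula g)
  | @All _ G0 s f =>
      All s (uninit_formula f : formula (V := V) (s :: (G0 ++ [None])))
  | @Ex _ G0 s f =>
      Ex s (uninit_formula f : formula (V := V) (s :: (G0 ++ [None])))
  end.

Definition uninit_sentence (psi : sentence V) : sentence V :=
  All (None : ty V) (uninit_formula psi).

Definition uninit_head (G : list (ty V)) (h : head G) :
    head (V := V) (G ++ [None]) :=
  match h with
  | HPred p args => HPred p (uninit_tms args)
  | HFun f args v => HFun f (uninit_tms args) (uninit_tm v)
  end.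

Definition uninit_rule (r : rule V) : rule V :=
  {| rctx := (rctx r ++ [None] : list (ty V));
     rhead := uninit_head (rhead r);
     rbody := uninit_formula (rbody r) |}.

End LinearTime.

Fixpoint strip (B : Type) (l : list (option B)) : list B :=
  match l with
  | [] => []
  | None :: l' => strip l'
  | Some s :: l' => s :: strip l'
  end.

Lemma strip_static_args (B : Type) (l : list B) : strip (static_args l) = l.
Proof. induction l as [|s l IH]; simpl; [|f_equal]; auto. Qed.

Lemma strip_dynamic_args (B : Type) (l : list B) : strip (dynamic_args l) = l.
Proof. induction l as [|s l IH]; simpl; [|f_equal]; auto. Qed.

(* State vocabularies: the static symbols, and one copy of each dynamic symbol
   for each element of X, with the Time argument removed. *)
Inductive state_sym (X St Dy : Type) : Type :=
| Stat : St -> state_sym X St Dy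
| At : X -> Dy -> state_sym X St Dy.
Arguments Stat {X St Dy} f.
Arguments At {X St Dy} x f.

Definition state_voc (S : lt_vocabulary) (X : Type) : vocabulary :=
  {| ty := sort S;
     fsym := state_sym X (sfun S) (dfun S);
     fargs := fun f =>
       match f with
       | Stat g => strip (static_args (sfun_args g))
       | At _ g => strip (dynamic_args (dfun_args g))
       end;
     fres := fun f =>
       match f with
       | Stat g => sfun_res g
       | At _ g => dfun_res g
       end;
     psym := state_sym X (spred S) (dpred S);
     pargs := fun p =>
       match p with
       | Stat q => strip (static_args (spred_args q))
       | At _ q => strip (dynamic_args (dpred_args q))
       end |}.

Inductive phase : Type := Cur | Nxt.

(* The copy of a dynamic symbol s usually written s° is [At tt s] in the
   single-state vocabulary and [At Cur s] in the bistate one, where s+ is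
   [At Nxt s]. *)
Definition ss_voc (S : lt_vocabulary) : vocabulary := state_voc S unit.
Definition bs_voc (S : lt_vocabulary) : vocabulary := state_voc S phase.

Section TimeElimination.

Context (S : lt_vocabulary) (X : Type) (eqbX : X -> X -> bool).
Context (copy : forall G : list (ty (lt_voc S)), time_term G -> X).

Local Notation V := (lt_voc S).
Local Notation W := (state_voc S X).

Definition te_var_type (G : list (sort S)) (s : option (sort S)) : Type :=
  match s with
  | None => unit
  | Some s' => var G s'
  end.

Fixpoint te_var (G : list (option (sort S))) (s : option (sort S))
    (x : var G s) : te_var_type (strip G) s :=
  match x in var G0 s0 return te_var_type (strip G0) s0 with
  | @VZ _ G0 s0 =>
      match s0 return te_var_type (strip (s0 :: G0)) s0 with
      | None => tt
      | Some _ => VZ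
      end
  | @VS _ G0 s0 s1 y =>
      match s1 return te_var_type (strip (s1 :: G0)) s0 with
      | None => te_var y
      | Some _ =>
          match s0 return te_var_type (strip G0) s0 ->
                          te_var_type (_ :: strip G0) s0 with
          | None => fun _ => tt
          | Some _ => fun y0 => VS y0
          end (te_var y)
      end
  end.

Definition te_tm_type (G : list (sort S)) (s : option (sort S)) : Type :=
  match s with
  | None => unit
  | Some s' => term (V := W) G s'
  end.

Fixpoint te_tm (G : list (ty V)) (s : ty V) (a : term G s) {struct a} :
    te_tm_type (strip G) s :=
  match a in term _ s0 return te_tm_type (strip G) s0 with
  | @Var _ _ s0 x =>
      match s0 return te_var_type (strip G) s0 -> te_tm_type (strip G) s0 with
      | None => fun _ => tt
      | Some _ => fun x0 => Var (V := W) x0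
      end (te_var x)
  | App f args =>
      match f return
        terms (V := V) G (fargs (v := V) f) ->
        terms (V := W) (strip G) (strip (fargs (v := V) f)) ->
        te_tm_type (strip G) (fres (v := V) f)
      with
      | FInit => fun _ _ => tt
      | FSucc => fun _ _ => tt
      | FStat g => fun _ args' => App (V := W) (Stat g : fsym W) args'
      | FDyn g => fun args0 args' =>
          App (V := W) (At (copy (time_arg args0)) g : fsym W) args'
      end args (te_tms args)
  end
with te_tms (G : list (ty V)) (l : list (ty V)) (args : terms G l)
    {struct args} : terms (V := W) (strip G) (strip l) :=
  match args in terms _ l0 return terms (V := W) (strip G) (strip l0) with
  | tnil => tnil
  | @tcons _ _ s l0 a args' =>
      match s return te_tm_type (strip G) s ->
                     terms (V := W) (strip G) (strip (s :: l0)) with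
      | None => fun _ => te_tms args'
      | Some _ => fun a0 => tcons (V := W) a0 (te_tms args')
      end (te_tm a)
  end.

(* Quantifiers over Time are dropped. An equation between Time-terms is
   replaced by its truth value, t and S(t) being distinct. *)
Fixpoint te_formula (G : list (ty V)) (phi : formula G) :
    formula (V := W) (strip G) :=
  match phi in formula G0 return formula (V := W) (strip G0) with
  | Top => Top
  | Bot => Bot
  | @Atom _ G0 p args =>
      match p return
        terms (V := V) G0 (pargs (v := V) p) -> formula (V := W) (strip G0)
      with
      | PStat q => fun args0 =>
          Atom (V := W) (Stat q : psym W) (te_tms args0)
      | PDyn q => fun args0 =>
          Atom (V := W) (At (copy (time_arg args0)) q : psym W) (te_tms args0)
      end args
  | @Eq _ G0 s a b =>
      match s return
        term (V := V) G0 s -> term (V := V) G0 s -> formula (V := W) (strip G0)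
      with
      | None => fun a0 b0 => if eqbX (copy a0) (copy b0) then Top else Bot
      | Some _ => fun a0 b0 => Eq (V := W) (te_tm a0) (te_tm b0)
      end a b
  | Not f => Not (te_formula f)
  | And f g => And (te_formula f) (te_formula g)
  | Or f g => Or (te_formula f) (te_formula g)
  | @All _ G0 s f =>
      match s return
        formula (V := W) (strip (s :: G0)) -> formula (V := W) (strip G0)
      with
      | None => fun f0 => f0
      | Some s' => fun f0 => All (V := W) (s' : ty W) f0
      end (te_formula f)
  | @Ex _ G0 s f =>
      match s return
        formula (V := W) (strip (s :: G0)) -> formula (V := W) (strip G0)
      with
      | None => fun f0 => f0
      | Some s' => fun f0 => Ex (V := W) (s' : ty W) f0
      end (te_formula f)
  end.

(* [None] only for the heads excluded by [defines_lt_symbol]. *)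
Definition te_head (G : list (ty V)) (h : head G) :
    option (head (V := W) (strip G)) :=
  match h with
  | HPred p args =>
      match p return
        terms (V := V) G (pargs (v := V) p) ->
        option (head (V := W) (strip G))
      with
      | PStat q => fun args0 =>
          Some (HPred (V := W) (Stat q : psym W) (te_tms args0))
      | PDyn q => fun args0 =>
          Some (HPred (V := W) (At (copy (time_arg args0)) q : psym W)
                  (te_tms args0))
      end args
  | HFun f args v =>
      match f return
        terms (V := V) G (fargs (v := V) f) ->
        term (V := V) G (fres (v := V) f) ->
        option (head (V := W) (strip G))
      with
      | FInit => fun _ _ => None
      | FSucc => fun _ _ => None
      | FStat g => fun args0 v0 =>
          Some (HFun (V := W) (Stat g : fsym W) (te_tms args0) (te_tm v0))
      | FDyn g => fun args0 v0 =>
          Some (HFun (V := W) (At (copy (time_arg args0)) g : fsym W)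
                  (te_tms args0) (te_tm v0))
      end args v
  end.

Definition te_rule (r : rule V) : option (rule W) :=
  match te_head (rhead r) with
  | Some h =>
      Some {| rctx := (strip (rctx r) : list (ty W));
              rhead := h;
              rbody := te_formula (rbody r) |}
  | None => None
  end.

End TimeElimination.

Section Projections.

Context (S : lt_vocabulary).

Local Notation V := (lt_voc S).

Definition copy_ss (G : list (ty V)) (a : time_term G) : unit := tt.

Definition copy_bs (G : list (ty V)) (a : time_term G) : phase :=
  match a with
  | App FSucc _ => Nxt
  | _ => Cur
  end.

Definition eqb_phase (x y : phase) : bool :=
  match x, y with
  | Cur, Cur => true
  | Nxt, Nxt => true
  | _, _ => false
  end.

Definition te_ss (psi : sentence V) : sentence (ss_voc S) :=
  te_formula (fun _ _ => true) copy_ss psi.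
Definition te_ss_rule (r : rule V) : option (rule (ss_voc S)) :=
  te_rule (fun _ _ => true) copy_ss r.
Definition te_bs (psi : sentence V) : sentence (bs_voc S) :=
  te_formula eqb_phase copy_bs psi.
Definition te_bs_rule (r : rule V) : option (rule (bs_voc S)) :=
  te_rule eqb_phase copy_bs r.

(* On static sentences and rules, time-elimination is the mere change of
   vocabulary. *)
Definition initial_theory (T : theory V) : theory (ss_voc S) :=
  {| sentences := fun psi' => exists psi, sentences T psi /\
       ((static_sentence psi /\ psi' = te_ss psi) \/
        (initial_sentence psi /\ psi' = te_ss (uninit_sentence psi)) \/
        (universal_single_state psi /\ psi' = te_ss psi));
     definition := fun r' => exists r, definition T r /\
       ((static_rule r /\ Some r' = te_ss_rule r) \/
        (initial_rule r /\ Some r' = te_ss_rule (uninit_rule r)) \/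
        (single_state_rule r /\ Some r' = te_ss_rule r)) |}.

Definition transition_theory (T : theory V) : theory (bs_voc S) :=
  {| sentences := fun psi' => exists psi, sentences T psi /\
       ((static_sentence psi /\ psi' = te_bs psi) \/
        (universal_single_state psi /\
           (psi' = te_bs psi \/ psi' = te_bs (succ_formula psi))) \/
        (universal_bistate psi /\ psi' = te_bs psi));
     definition := fun r' => exists r, definition T r /\
       ((static_rule r /\ Some r' = te_bs_rule r) \/
        (single_state_rule r /\
           (Some r' = te_bs_rule r \/ Some r' = te_bs_rule (succ_rule r))) \/
        (bistate_rule r /\ Some r' = te_bs_rule r)) |}.

End Projections.

(* Main.v *)
(* Induct on the time point: the snapshot of a model J of T at time 0 should
   satisfy the initial theory, and the pair of snapshots at k and k + 1 the
   transition theory. The sentences are immediate; the definitions are not, as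
   the well-founded semantics is global. But J interprets the definition by a
   total well-founded model, and such a model remains well-founded for any set of
   ground rules containing all the rules for the atoms it defines, the other
   atoms being opened at their values in J. Stratification over time makes each
   projected definition such a set: instances at other time points, or in an
   excluded rule class, never derive an atom of a symbol it defines. *)
Require Import Defs.
From Stdlib Require Import List Classical PeanoNat.
Import ListNotations.

Set Implicit Arguments.
Unset Strict Implicit.

(* The alternating fixpoints of the full and of the projected definition need not proceed in step:
   the projected one has its open atoms at their final values from the start. Totality of the model
   bridges the gap. Once opened, both the true and the possible atoms of the full definition
   coincide with truth, so a set closed for the projected definition can be glued to the true atoms
   elsewhere and stays closed for the full one.

   Syntax is compared at the level of three-valued interpretations: terms denote relative to an
   arbitrary set K of atoms, and ordinary satisfaction is the case where K is truth. The price is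
   that Time-terms are read off K as well, whence the condition [time_standard].

   Static, initial, single-state (at t or at S(t)) and bistate time-elimination are then instances
   of one correspondence, whose parameters are the copy that a Time-term selects and the time at
   which each copy is read. *)
Scheme term_terms_ind := Induction for term Sort Prop
with terms_term_ind := Induction for terms Sort Prop.
Combined Scheme term_mutind from term_terms_ind, terms_term_ind.

Lemma terms_cons_eta (S : lt_vocabulary) (G : list (ty (lt_voc S)))
    (s : ty (lt_voc S)) (l : list (ty (lt_voc S))) (args : terms G (s :: l)) :
  args = tcons (terms_hd args) (terms_tl args).
Proof.
  exact (match args as args0 in terms _ l0
    return match l0 return terms G l0 -> Prop with
           | [] => fun _ => True
           | s0 :: l1 => fun args1 => args1 = tcons (terms_hd args1) (terms_tl args1)
           end args0 with
    | tnil => I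
    | tcons _ _ => eq_refl
    end).
Qed.

Lemma terms_nil_eta (V : vocabulary) (G : list (ty V))
    (args : terms G []) :
  args = tnil.
Proof.
  exact (match args as args0 in terms _ l0
    return match l0 return terms G l0 -> Prop with
           | [] => fun args1 => args1 = tnil
           | _ :: _ => fun _ => True
           end args0 with
    | tnil => eq_refl
    | tcons _ _ => I
    end).
Qed.

(** * Well-founded models *)

Section Kleene.

Context (V : vocabulary) (A : structure V).
Implicit Types (K L U : datom A -> Prop) (G : list (ty V)).

Lemma den_holds G (e : hlist (dom A) G) :
  (forall s (a : term G s) d, den (@holds V A) e a d <-> eval e a = d) /\
  (forall l (args : terms G l) ds,
     dens (@holds V A) e args ds <-> evals e args = ds).
Proof.
  apply term_mutind; simpl.
  - reflexivity.
  - intros f args IH d. split.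
    + intros [ds [H1 H2]]. apply IH in H1. subst ds. exact H2.
    + intros H. exists (evals e args). split; [apply IH; reflexivity | exact H].
  - intros []. tauto.
  - intros s l a IHa args IHargs [d ds]; simpl.
    rewrite IHa, IHargs. split; [intros []; congruence | intros H; now inversion H].
Qed.

Lemma ktrue_holds G (phi : formula G) (e : hlist (dom A) G) :
  ktrue (@holds V A) (@holds V A) phi e <-> sat phi e.
Proof.
  induction phi as [G|G|G p args|G s a b|G f IH|G f IHf g IHg|G f IHf g IHg
                   |G s f IH|G s f IH]; simpl.
  - tauto.
  - tauto.
  - split.
    + intros [ds [H1 H2]]. apply den_holds in H1. now subst ds.
    + intros H. exists (evals e args). now split; [apply den_holds |].
  - split.
    + intros [d [H1 H2]]. apply den_holds in H1, H2. congruence.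
    + intros H. exists (eval e b). now split; apply den_holds.
  - now rewrite IH.
  - now rewrite IHf, IHg.
  - now rewrite IHf, IHg.
  - split; intros H d; apply IH, H.
  - split; intros [d H]; exists d; apply IH, H.
Qed.

Lemma den_mono K L G (e : hlist (dom A) G) :
  (forall a, K a -> L a) ->
  (forall s (a : term G s) d, den K e a d -> den L e a d) /\
  (forall l (args : terms G l) ds, dens K e args ds -> dens L e args ds).
Proof.
  intros KL. apply term_mutind; simpl.
  - trivial.
  - intros f args IH d [ds [H1 H2]]. eauto.
  - trivial.
  - intros s l a IHa args IHargs ds [H1 H2]. eauto.
Qed.

Lemma ktrue_mono G (phi : formula G) (e : hlist (dom A) G) :
  forall L U L' U', (forall a, L a -> L' a) -> (forall a, U' a -> U a) ->
  ktrue L U phi e -> ktrue L' U' phi e.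
Proof.
  induction phi as [G|G|G p args|G s a b|G f IH|G f IHf g IHg|G f IHf g IHg
                   |G s f IH|G s f IH]; simpl; intros L U L' U' HL HU.
  - trivial.
  - trivial.
  - intros [ds [H1 H2]]. exists ds. split; [|auto].
    exact (proj2 (den_mono e HL) _ _ _ H1).
  - intros [d [H1 H2]]. exists d.
    split; apply (proj1 (den_mono e HL)); assumption.
  - intros H1 H2. apply H1. revert H2. now apply IH.
  - intros []; split; eauto.
  - intros []; eauto.
  - intros H d. eauto.
  - intros [d H]. eauto.
Qed.

Definition rule_instance L U (r : rule V) (e : hlist (dom A) (rctx r))
    (a : datom A) : Prop :=
  head_instance L (rhead r) e a /\ ktrue L U (rbody r) e.

Lemma rule_instance_mono L U L' U' (r : rule V) e a :
  (forall a, L a -> L' a) -> (forall a, U' a -> U a) ->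
  @rule_instance L U r e a -> @rule_instance L' U' r e a.
Proof.
  intros HL HU [H1 H2]. split; [|exact (ktrue_mono HL HU H2)].
  pose proof (den_mono e HL) as [M1 M2].
  destruct (rhead r) as [p args|f args v]; simpl in *.
  - destruct H1 as [ds [H1 ->]]. exists ds. auto.
  - destruct H1 as [ds [d [H1 [H3 ->]]]]. exists ds, d. auto.
Qed.

Lemma head_instance_dsym K G (h : Defs.head G) (e : hlist (dom A) G) a :
  head_instance K h e a -> dsym a = hsym h.
Proof.
  destruct h as [p args|f args v]; simpl.
  - now intros [ds [_ ->]].
  - now intros [ds [d [_ [_ ->]]]].
Qed.

End Kleene.

(** * Order properties of the alternating fixpoint *)

Section WellFounded.

Context (V : vocabulary) (A : structure V) (Delta : rule V -> Prop).
Implicit Types (X Y L U : datom A -> Prop).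

Lemma with_open_mono X Y :
  (forall a, X a -> Y a) ->
  forall a, with_open Delta X a -> with_open Delta Y a.
Proof. unfold with_open. intros H a. intuition. Qed.

Lemma derives_mono L U L' U' a :
  (forall a, with_open Delta L a -> with_open Delta L' a) ->
  (forall a, with_open Delta U' a -> with_open Delta U a) ->
  derives Delta L U a -> derives Delta L' U' a.
Proof.
  intros HL HU [r [Hr [e He]]]. exists r. split; [exact Hr|]. exists e.
  exact (rule_instance_mono HL HU He).
Qed.

Lemma stable_closed U a : derives Delta (stable Delta U) U a -> stable Delta U a.
Proof.
  intros H X HX. apply HX. revert H.
  apply derives_mono; [|trivial]. apply with_open_mono.
  intros b Hb. exact (Hb X HX).
Qed.

Lemma stable_antitone X Y :
  (forall a, X a -> Y a) -> forall a, stable Delta Y a -> stable Delta X a.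
Proof.
  intros H a Ha. apply Ha. intros b Hb. apply stable_closed. revert Hb.
  apply derives_mono; [trivial | now apply with_open_mono].
Qed.

Lemma wf_true_closed a :
  stable Delta (stable Delta (wf_true (A := A) Delta)) a -> wf_true Delta a.
Proof.
  intros H X HX. apply HX. revert a H.
  do 2 apply stable_antitone. intros a Ha. exact (Ha X HX).
Qed.

Lemma wf_true_unfold a :
  wf_true (A := A) Delta a ->
  stable Delta (stable Delta (wf_true Delta)) a.
Proof.
  intros H. apply H. do 2 apply stable_antitone. exact wf_true_closed.
Qed.

(** Write T for the true atoms and P = [stable] T. Since T lies in [stable] P by [wf_true_unfold],
    reversing the inclusion once more shows that P is closed under the squared operator, of which T
    is the least closed set. *)
Lemma wf_true_possible a : wf_true (A := A) Delta a -> wf_possible Delta a.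
Proof.
  intros H. apply H. unfold wf_possible.
  apply stable_antitone. exact wf_true_unfold.
Qed.

Lemma with_open_iff X :
  (forall a, defined Delta (dsym a) -> (X a <-> holds a)) ->
  forall a, with_open Delta X a <-> holds a.
Proof.
  intros H a. unfold with_open. specialize (H a).
  destruct (classic (defined Delta (dsym a))); tauto.
Qed.

End WellFounded.

(* A total well-founded model stays one when a definition is cut down to the
   rules for some of its atoms (B's, embedded by iota) and the others are
   opened: every rule for a kept atom must be kept, but no stratification is
   needed. *)
Section Splitting.

Context (V W : vocabulary) (A : structure V) (B : structure W).
Context (Delta : rule V -> Prop) (Gamma : rule W -> Prop).
Context (iota : datom B -> datom A).

Let pull (K : datom A -> Prop) (b : datom B) : Prop := K (iota b).

Hypothesis holds_iota : forall b, holds (iota b) <-> holds b.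
Hypothesis defined_iota :
  forall b, defined Gamma (dsym b) -> defined Delta (dsym (iota b)).
Hypothesis sound : forall L U r e b, Gamma r ->
  @rule_instance W B (pull (with_open Delta L)) (pull (with_open Delta U)) r e b ->
  derives Delta L U (iota b).
Hypothesis complete : forall L U b, defined Gamma (dsym b) ->
  derives Delta L U (iota b) ->
  exists r, Gamma r /\ exists e,
    @rule_instance W B (pull (with_open Delta L)) (pull (with_open Delta U)) r e b.

Lemma derives_iota L U L' U' b :
  (forall c, with_open Gamma L' c -> with_open Delta L (iota c)) ->
  (forall c, with_open Delta U (iota c) -> with_open Gamma U' c) ->
  derives Gamma L' U' b -> derives Delta L U (iota b).
Proof.
  intros HL HU [r [Hr [e He]]]. apply (sound (e := e) Hr).
  exact (rule_instance_mono HL HU He).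
Qed.

Lemma derives_pull L U L' U' b :
  defined Gamma (dsym b) ->
  (forall c, with_open Delta L (iota c) -> with_open Gamma L' c) ->
  (forall c, with_open Gamma U' c -> with_open Delta U (iota c)) ->
  derives Delta L U (iota b) -> derives Gamma L' U' b.
Proof.
  intros Hb HL HU H. destruct (complete Hb H) as [r [Hr [e He]]].
  exists r. split; [exact Hr|]. exists e.
  exact (rule_instance_mono HL HU He).
Qed.

Hypothesis model : sat_definition A Delta.

Let T := wf_true (A := A) Delta.
Let P := wf_possible (A := A) Delta.

Lemma with_open_true a : with_open Delta T a <-> holds a.
Proof. apply with_open_iff. intros b Hb. apply model, Hb. Qed.

Lemma with_open_possible a : with_open Delta P a <-> holds a.
Proof. apply with_open_iff. intros b Hb. apply model, Hb. Qed.

Lemma holds_with_open (X : datom B -> Prop) b :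
  (defined Gamma (dsym b) -> X b) -> holds b -> with_open Gamma X b.
Proof.
  unfold with_open. destruct (classic (defined Gamma (dsym b))); tauto.
Qed.

(** Leastness of T is applied to a glued test set Y: on kept atoms that [Gamma] defines it demands
    membership in X, on all others it is T. Because T is truth, the open atoms of [Gamma] then have
    the same value on both sides. *)
Lemma wf_true_iota b :
  defined Gamma (dsym b) -> T (iota b) -> wf_true (A := B) Gamma b.
Proof.
  intros Hb HT X HX.
  pose (Y := fun a => T a /\
    forall b, iota b = a -> defined Gamma (dsym b) -> X b).
  enough (HY : forall a, stable Delta (stable Delta Y) a -> Y a).
  { exact (proj2 (HT Y HY) b eq_refl Hb). }
  assert (YT : forall a, Y a -> T a) by (intros a []; assumption).
  assert (PU : forall a, P a -> stable Delta Y a) by (apply stable_antitone, YT).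
  (* Totality enters here: whatever holds is possible or open, so it survives in every overestimate
     computed from a subset of T. *)
  assert (holdsU : forall a, holds a -> with_open Delta (stable Delta Y) a).
  { intros a Ha. apply (with_open_mono PU), with_open_possible, Ha. }
  (* Overestimates compare along [iota]. This direction only needs that kept rules are sound. *)
  assert (UU : forall b, stable Gamma X b -> stable Delta Y (iota b)).
  { intros c Hc. apply (Hc (fun c => stable Delta Y (iota c))).
    intros c' H. apply stable_closed. revert H. apply derives_iota.
    - intros c0 [[H1 H2]|[H1 H2]].
      + left. split; [apply defined_iota, H1 | exact H2].
      + apply holdsU, holds_iota, H2.
    - intros c0 H. apply holds_with_open.
      + intros Hd. destruct H as [[_ H]|[H _]].
        * exact (proj2 H c0 eq_refl Hd).
        * destruct (H (defined_iota Hd)).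
      + apply holds_iota, with_open_true. exact (with_open_mono YT H). }
  intros a Ha. split.
  { apply wf_true_closed. revert a Ha. do 2 apply stable_antitone. exact YT. }
  intros c <- Hc. apply HX.
  (* The same gluing for the inner least fixpoint, now with P outside the kept part. Pulling a
     derivation back to [Gamma] is where completeness of the kept rules is needed. *)
  pose (Z := fun a => P a /\ forall b, iota b = a -> defined Gamma (dsym b) ->
    stable Gamma (stable Gamma X) b).
  enough (HZ : forall a, derives Delta Z (stable Delta Y) a -> Z a).
  { exact (proj2 (Ha Z HZ) c eq_refl Hc). }
  assert (ZP : forall a, Z a -> P a) by (intros a []; assumption).
  intros a H. split.
  { apply stable_closed. revert H. apply derives_mono.
    - apply with_open_mono, ZP.
    - intros b' Hb'. apply holdsU, with_open_true, Hb'. }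
  intros b' <- Hb'. apply stable_closed. revert H. apply (derives_pull Hb').
  - intros c0 H. apply holds_with_open.
    + intros Hd. destruct H as [[_ H]|[H _]].
      * exact (proj2 H c0 eq_refl Hd).
      * destruct (H (defined_iota Hd)).
    + apply holds_iota, with_open_possible. exact (with_open_mono ZP H).
  - intros c0 [[H1 H2]|[H1 H2]].
    + left. split; [apply defined_iota, H1 | exact (UU _ H2)].
    + apply holdsU, holds_iota, H2.
Qed.

(** True atoms are well-founded by the previous lemma. Conversely P, pulled back along [iota], is
    closed under the rules of [Gamma] with negated atoms at their true values, so it contains all
    possible atoms. The other two directions follow because true atoms are possible. *)
Lemma sat_definition_split : sat_definition B Gamma.
Proof.
  assert (true_of_holds : forall b, defined Gamma (dsym b) -> holds b ->
    wf_true (A := B) Gamma b).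
  { intros b Hb H. apply (wf_true_iota Hb).
    apply (proj2 (proj1 (model (defined_iota Hb)))), holds_iota, H. }
  assert (holds_of_possible : forall b, defined Gamma (dsym b) ->
    wf_possible (A := B) Gamma b -> holds b).
  { intros b Hb H. apply holds_iota, (proj1 (proj2 (model (defined_iota Hb)))).
    apply (H (fun b => P (iota b))). intros c Hc.
    apply stable_closed. revert Hc. apply derives_iota.
    - intros c0 [[H1 H2]|[H1 H2]].
      + left. split; [apply defined_iota, H1 | exact H2].
      + apply with_open_possible, holds_iota, H2.
    - intros c0 H0. apply with_open_true, holds_iota in H0.
      apply holds_with_open; auto. }
  intros b Hb. split; split; intros H; auto using wf_true_possible.
Qed.

End Splitting.

(** * Snapshots and time-elimination *)

Section TimeComponents.

Context (B : Type) (D : B -> Type).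

(* [strip] forgets the Time components; [at_time k] restores them all as [k]. *)
Fixpoint at_time (k : nat) (l : list (option B)) :
    hlist D (strip l) -> hlist (lt_dom D) l :=
  match l with
  | [] => fun _ => tt
  | None :: l' => fun ds => (k, @at_time k l' ds)
  | Some _ :: l' => fun ds => (fst ds, @at_time k l' (snd ds))
  end.

Fixpoint drop_time (l : list (option B)) :
    hlist (lt_dom D) l -> hlist D (strip l) :=
  match l with
  | [] => fun _ => tt
  | None :: l' => fun ds => @drop_time l' (snd ds)
  | Some _ :: l' => fun ds => (fst ds, @drop_time l' (snd ds))
  end.

Lemma drop_at_time k (l : list (option B)) (ds : hlist D (strip l)) :
  drop_time (at_time k ds) = ds.
Proof.
  induction l as [|[s|] l IH]; simpl in *.
  - now destruct ds.
  - rewrite IH. now destruct ds.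
  - apply IH.
Qed.

Fixpoint last_time (l : list B) : hlist (lt_dom D) (dynamic_args l) -> nat :=
  match l with
  | [] => fun ds => fst ds
  | _ :: l' => fun ds => @last_time l' (snd ds)
  end.

Lemma last_at_time k (l : list B) (ds : hlist D (strip (dynamic_args l))) :
  last_time (at_time k ds) = k.
Proof. induction l as [|s l IH]; [reflexivity | apply IH]. Qed.

End TimeComponents.

(** * Environments and their Time components *)

Section Environments.

Context (S : lt_vocabulary) (D : sort S -> Type).
Local Notation V := (lt_voc S).

Lemma at_drop_time_static k (G : list (option (sort S))) :
  count_time G = 0 -> forall e : hlist (lt_dom D) G, at_time k (drop_time e) = e.
Proof.
  induction G as [|[s|] G IH]; simpl; intros H e.
  - now destruct e.
  - destruct e. simpl. now rewrite IH.
  - discriminate.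
Qed.

(** k is the value of the only Time variable. This is what assigns a time point to each ground
    instance of a single-state or bistate rule. *)
Lemma at_time_exists (G : list (option (sort S))) :
  count_time G = 1 -> forall e : hlist (lt_dom D) G,
  exists k, at_time k (drop_time e) = e.
Proof.
  induction G as [|[s|] G IH]; simpl; intros H e.
  - discriminate.
  - destruct e as [d e]. simpl. destruct (IH H e) as [k Hk].
    exists k. now rewrite Hk.
  - destruct e as [k e]. injection H as H. exists k. simpl.
    now rewrite at_drop_time_static.
Qed.

(** Semantic counterpart of the fresh outermost variable, which in de Bruijn order stands at the end
    of the context. *)
Fixpoint snoc_time (k : nat) (G : list (option (sort S))) :
    hlist (lt_dom D) G -> hlist (lt_dom D) (G ++ [None]) :=
  match G with
  | [] => fun _ => (k, tt)
  | _ :: G' => fun e => (fst e, @snoc_time k G' (snd e))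
  end.

Lemma at_drop_snoc_time k (G : list (option (sort S))) :
  count_time G = 0 -> forall e : hlist (lt_dom D) G,
  at_time k (drop_time (snoc_time k e)) = snoc_time k e.
Proof.
  induction G as [|[s|] G IH]; simpl; intros H e.
  - reflexivity.
  - now rewrite IH.
  - discriminate.
Qed.

Lemma at_time_snoc k (G : list (option (sort S)))
    (e : hlist D (strip (G ++ [None]))) :
  exists e0 : hlist (lt_dom D) G, at_time k e = snoc_time k e0.
Proof.
  induction G as [|[s|] G IH]; simpl in *.
  - now exists tt.
  - destruct (IH (snd e)) as [e0 H]. exists (fst e, e0). exact (f_equal _ H).
  - destruct (IH e) as [e0 H]. exists (k, e0). exact (f_equal _ H).
Qed.

Lemma hget_snoc k (G : list (option (sort S))) s (x : var G s)
    (e : hlist (lt_dom D) G) :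
  hget (var_app x [None]) (snoc_time k e) = hget x e.
Proof. induction x; simpl; [reflexivity | apply IHx]. Qed.

Lemma hget_last k (G : list (option (sort S))) (e : hlist (lt_dom D) G) :
  hget (var_last G None) (snoc_time k e) = k.
Proof. induction G as [|s G IH]; simpl; [reflexivity | apply IH]. Qed.

(** A Time variable has no image in the stripped context, so the two kinds of variables need
    separate conclusions. *)
Lemma hget_at_time k (G : list (option (sort S))) s (x : var G s)
    (e : hlist D (strip G)) :
  match s return var G s -> lt_dom D s -> Prop with
  | None => fun _ d => d = k
  | Some s' => fun x0 d => d = hget (te_var x0 : var (strip G) s') e
  end x (hget x (at_time k e)).
Proof.
  induction x as [G s|G s s' x IH].
  - now destruct s.
  - destruct s' as [s'|]; simpl.
    + specialize (IH (snd e)). destruct s as [s|]; exact IH.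
    + specialize (IH e). destruct s as [s|]; exact IH.
Qed.

End Environments.

(** * Snapshots of a linear-time model and the correctness of time-elimination *)

Section States.

Context (S : lt_vocabulary) (J : lt_structure S).
Context (X : Type) (tm : X -> nat).

Local Notation V := (lt_voc S).
Local Notation W := (state_voc S X).
Local Notation D := (@ldom S J).

(* The snapshot of J in which the copy x of a dynamic symbol is read at time
   [tm x]: J_0 for the initial theory, (J_k, J_(k+1)) for the transition one. *)
Definition state : structure W :=
  {| dom := (D : ty W -> Type);
     dom_inhabited := ldom_inhabited J;
     fint := fun f : fsym W =>
       match f return hlist D (fargs (v := W) f) -> D (fres (v := W) f) with
       | Stat g => fun ds => sfun_int (l := J) (f := g) (at_time 0 ds)
       | At x g => fun ds => dfun_int (l := J) (f := g) (at_time (tm x) ds)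
       end;
     pint := fun p : psym W =>
       match p return hlist D (pargs (v := W) p) -> Prop with
       | Stat q => fun ds => spred_int (l := J) (p := q) (at_time 0 ds)
       | At x q => fun ds => dpred_int (l := J) (p := q) (at_time (tm x) ds)
       end |}.

(** This is the embedding to which the splitting result is applied. The 0 for static symbols is a
    dummy: their arguments have no Time component to fill. *)
Definition timed_atom (b : datom state) : datom (lt_str J) :=
  match b with
  | @DPred _ _ p ds =>
      match p return hlist D (pargs (v := W) p) -> datom (lt_str J) with
      | Stat q => fun ds0 =>
          @DPred V (lt_str J) (PStat q) (at_time 0 ds0)
      | At x q => fun ds0 =>
          @DPred V (lt_str J) (PDyn q) (at_time (tm x) ds0)
      end ds
  | @DFun _ _ f ds d =>
      match f return hlist D (fargs (v := W) f) -> D (fres (v := W) f) ->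
        datom (lt_str J) with
      | Stat g => fun ds0 d0 =>
          @DFun V (lt_str J) (FStat g) (at_time 0 ds0) d0
      | At x g => fun ds0 d0 =>
          @DFun V (lt_str J) (FDyn g) (at_time (tm x) ds0) d0
      end ds d
  end.

Lemma holds_timed_atom b : holds (timed_atom b) <-> holds b.
Proof. destruct b as [[q|x q] ds|[g|x g] ds d]; reflexivity. Qed.

Definition lt_sym (q : psym W + fsym W) : psym V + fsym V :=
  match q with
  | inl (Stat p) => inl (PStat p : psym V)
  | inl (At _ p) => inl (PDyn p : psym V)
  | inr (Stat f) => inr (FStat f : fsym V)
  | inr (At _ f) => inr (FDyn f : fsym V)
  end.

Lemma dsym_timed_atom b : dsym (timed_atom b) = lt_sym (dsym b).
Proof. destruct b as [[q|x q] ds|[g|x g] ds d]; reflexivity. Qed.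

Definition atom_time (a : datom (lt_str J)) : option nat :=
  match a with
  | @DPred _ _ p ds =>
      match p return hlist (lt_dom D) (pargs (v := V) p) -> option nat with
      | PStat _ => fun _ => None
      | PDyn q => fun ds0 => Some (last_time (l := dpred_args (l:=S) q) ds0)
      end ds
  | @DFun _ _ f ds _ =>
      match f return hlist (lt_dom D) (fargs (v := V) f) -> option nat with
      | FDyn g => fun ds0 => Some (last_time (l := dfun_args (l:=S) g) ds0)
      | _ => fun _ => None
      end ds
  end.

Definition sym_copy (q : psym W + fsym W) : option X :=
  match q with
  | inl (At x _) => Some x
  | inr (At x _) => Some x
  | _ => None
  end.

Lemma atom_time_timed_atom b :
  atom_time (timed_atom b) = option_map tm (sym_copy (dsym b)).
Proof.
  destruct b as [[q|x q] ds|[g|x g] ds d]; simpl; try reflexivity;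
    f_equal; apply last_at_time.
Qed.

Context (copy_at : nat -> X) (copy_at_tm : forall x, copy_at (tm x) = x).

(** A left inverse of [timed_atom], built to prove injectivity; [copy_at] recovers the copy from the
    time point. [None] is met only on atoms of I and S, which are outside the image. *)
Definition untimed_atom (a : datom (lt_str J)) : option (datom state) :=
  match a with
  | @DPred _ _ p ds =>
      match p return
        hlist (lt_dom D) (pargs (v := V) p) -> option (datom state) with
      | PStat q => fun ds0 =>
          Some (@DPred W state (Stat q) (drop_time ds0))
      | PDyn q => fun ds0 =>
          Some (@DPred W state
            (At (copy_at (last_time (l := dpred_args (l:=S) q) ds0)) q)
            (drop_time ds0))
      end ds
  | @DFun _ _ f ds d =>
      match f return hlist (lt_dom D) (fargs (v := V) f) ->
        lt_dom D (fres (v := V) f) -> option (datom state) with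
      | FStat g => fun ds0 d0 =>
          Some (@DFun W state (Stat g) (drop_time ds0) d0)
      | FDyn g => fun ds0 d0 =>
          Some (@DFun W state
            (At (copy_at (last_time (l := dfun_args (l:=S) g) ds0)) g)
            (drop_time ds0) d0)
      | _ => fun _ _ => None
      end ds d
  end.

Lemma timed_atomK b : untimed_atom (timed_atom b) = Some b.
Proof.
  destruct b as [[q|x q] ds|[g|x g] ds d]; simpl.
  - now rewrite drop_at_time.
  - rewrite last_at_time, copy_at_tm. now rewrite drop_at_time.
  - now rewrite drop_at_time.
  - rewrite last_at_time, copy_at_tm. now rewrite drop_at_time.
Qed.

Lemma timed_atom_inj b c : timed_atom b = timed_atom c -> b = c.
Proof.
  intros H. apply (f_equal untimed_atom) in H.
  rewrite !timed_atomK in H. congruence.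
Qed.


(* Within [with_open Delta L], [I] and [S] keep their fixed interpretation. *)
Definition time_standard (K : datom (lt_str J) -> Prop) : Prop :=
  (forall ds d, K (@DFun V (lt_str J) FInit ds d) <-> d = 0) /\
  (forall ds d, K (@DFun V (lt_str J) FSucc ds d) <->
     d = Datatypes.S (fst ds)).

Lemma holds_standard : time_standard (@holds V (lt_str J)).
Proof. split; intros ds d; simpl; split; congruence. Qed.

Context (eqbX : X -> X -> bool).
Hypothesis eqbX_tm : forall x y, eqbX x y = true <-> tm x = tm y.
Context (copy : forall G : list (ty V), time_term G -> X).
Context (Q : forall G : list (ty V), time_term G -> Prop) (k : nat).

(* With every Time variable valued [k], the Time-terms in Q denote the time
   point of the copy that [copy] selects for them. *)
Definition copy_reads : Prop :=
  forall K, time_standard K -> forall G (a : time_term G), Q a ->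
  forall (e : hlist D (strip G)) (d : nat),
    den (A := lt_str J) K (at_time k e) a d <-> d = tm (copy a).
Hypothesis reads : copy_reads.

(** Induction on argument lists meets arbitrary type lists, with several Time slots that may select
    different copies, so each slot is filled separately. On the arguments of an actual symbol, with
    at most one slot, this collapses to [at_time]. *)
Fixpoint fill_time (G : list (ty V)) (l : list (ty V)) :
    terms G l -> hlist D (strip l) -> hlist (lt_dom D) l :=
  match l return terms G l -> hlist D (strip l) -> hlist (lt_dom D) l with
  | [] => fun _ _ => tt
  | None :: l' => fun args ds =>
      (tm (copy (terms_hd args)), fill_time (terms_tl args) ds)
  | Some _ :: l' => fun args ds =>
      (fst ds, fill_time (terms_tl args) (snd ds))
  end.

Lemma fill_static G (l : list (sort S))
    (args : terms (V := V) G (static_args l)) ds :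
  fill_time args ds = at_time 0 ds.
Proof.
  induction l as [|s l IH]; simpl in *; [reflexivity|].
  f_equal. apply IH.
Qed.

Lemma fill_dynamic G (l : list (sort S))
    (args : terms (V := V) G (dynamic_args l)) ds :
  fill_time args ds = at_time (tm (copy (time_arg args))) ds.
Proof.
  induction l as [|s l IH]; simpl in *; [reflexivity|].
  f_equal. apply IH.
Qed.

Lemma fill_pred_static G q (args : terms G (pargs (v := V) (PStat q))) ds :
  @DPred V (lt_str J) (PStat q) (fill_time args ds) =
  timed_atom (@DPred W state (Stat q) ds).
Proof. exact (f_equal (@DPred V (lt_str J) (PStat q)) (fill_static args ds)). Qed.

Lemma fill_pred_dynamic G q (args : terms G (pargs (v := V) (PDyn q))) ds :
  @DPred V (lt_str J) (PDyn q) (fill_time args ds) =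
  timed_atom (@DPred W state (At (copy (time_arg args)) q) ds).
Proof. exact (f_equal (@DPred V (lt_str J) (PDyn q)) (fill_dynamic args ds)). Qed.

Lemma fill_fun_static G g (args : terms G (fargs (v := V) (FStat g))) ds d :
  @DFun V (lt_str J) (FStat g) (fill_time args ds) d =
  timed_atom (@DFun W state (Stat g) ds d).
Proof.
  exact (f_equal (fun ds0 => @DFun V (lt_str J) (FStat g) ds0 d)
    (fill_static args ds)).
Qed.

Lemma fill_fun_dynamic G g (args : terms G (fargs (v := V) (FDyn g))) ds d :
  @DFun V (lt_str J) (FDyn g) (fill_time args ds) d =
  timed_atom (@DFun W state (At (copy (time_arg args)) g) ds d).
Proof.
  exact (f_equal (fun ds0 => @DFun V (lt_str J) (FDyn g) ds0 d)
    (fill_dynamic args ds)).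
Qed.

Let pull (K : datom (lt_str J) -> Prop) (b : datom state) : Prop :=
  K (timed_atom b).

(** Elimination sends Time-terms to [unit]; for them the comparison states the denoted time point
    instead. *)
Definition den_te (K : datom (lt_str J) -> Prop) G (e : hlist D (strip G)) s
    (a : term (V := V) G s) : lt_dom D s -> Prop :=
  match s return term (V := V) G s -> te_tm_type X (strip G) s ->
    lt_dom D s -> Prop with
  | None => fun a0 _ d => d = tm (copy a0)
  | Some s' => fun _ a' d => den (A := state) (pull K) e a' d
  end a (te_tm copy a).

Lemma den_te_iff K G (e : hlist D (strip G)) :
  time_standard K ->
  (forall s (a : term (V := V) G s), ttm Q a -> forall d,
     den (A := lt_str J) K (at_time k e) a d <-> den_te K e a d) /\
  (forall l (args : terms (V := V) G l), ttms Q args -> forall ds,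
     dens (A := lt_str J) K (at_time k e) args ds <->
     exists ds', ds = fill_time args ds' /\
       dens (A := state) (pull K) e (te_tms copy args) ds').
Proof.
  intros HK. apply term_mutind.
  - intros s x [H _] d. destruct s as [s|].
    + unfold den_te. simpl. pose proof (hget_at_time k x e) as E. simpl in E.
      rewrite E. reflexivity.
    + exact (reads HK H e d).
  - intros f args IH [H Hargs] d. specialize (IH Hargs).
    destruct f as [| |g|g].
    + exact (reads HK H e d).
    + exact (reads HK H e d).
    + unfold den_te. simpl. split.
      * intros [ds [H1 H2]]. apply IH in H1 as [ds' [-> H1]].
        exists ds'. split; [exact H1|].
        exact (eq_ind _ K H2 _ (fill_fun_static args ds' d)).
      * intros [ds' [H1 H2]]. exists (fill_time args ds').
        split; [apply IH; eauto|].
        exact (eq_ind_r K H2 (fill_fun_static args ds' d)).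
    + unfold den_te. simpl. split.
      * intros [ds [H1 H2]]. apply IH in H1 as [ds' [-> H1]].
        exists ds'. split; [exact H1|].
        exact (eq_ind _ K H2 _ (fill_fun_dynamic args ds' d)).
      * intros [ds' [H1 H2]]. exists (fill_time args ds').
        split; [apply IH; eauto|].
        exact (eq_ind_r K H2 (fill_fun_dynamic args ds' d)).
  - intros _ []. simpl. split; [intros _; now exists tt | trivial].
  - intros s l a IHa args IHargs [Ha Hargs] ds.
    specialize (IHa Ha). specialize (IHargs Hargs).
    destruct ds as [d ds]. simpl. rewrite IHa, IHargs. clear IHa IHargs.
    destruct s as [s|]; unfold den_te; simpl.
    + split.
      * intros [H1 [ds' [-> H2]]]. now exists (d, ds').
      * intros [[d' ds'] [E [H1 H2]]]. injection E as -> ->. eauto.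
    + split.
      * intros [-> [ds' [-> H2]]]. now exists ds'.
      * intros [ds' [E H2]]. injection E as -> ->. eauto.
Qed.

Lemma ktrue_te G (phi : formula (V := V) G) : time_terms Q phi ->
  forall L U, time_standard L -> time_standard U ->
  forall e : hlist D (strip G),
    ktrue (A := state) (pull L) (pull U) (te_formula eqbX copy phi) e <->
    ktrue (A := lt_str J) L U phi (at_time k e).
Proof.
  induction phi as [G|G|G p args|G s a b|G f IH|G f IHf g IHg|G f IHf g IHg
                   |G s f IH|G s f IH]; simpl; intros HQ L U HL HU e.
  - tauto.
  - tauto.
  - pose proof (proj2 (den_te_iff e HL) _ args HQ) as E.
    destruct p as [q|q]; simpl; split.
    + intros [ds [H1 H2]]. exists (fill_time args ds).
      split; [apply E; eauto|].
      exact (eq_ind_r L H2 (fill_pred_static args ds)).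
    + intros [ds [H1 H2]]. apply E in H1 as [ds' [-> H1]].
      exists ds'. split; [exact H1|].
      exact (eq_ind _ L H2 _ (fill_pred_static args ds')).
    + intros [ds [H1 H2]]. exists (fill_time args ds).
      split; [apply E; eauto|].
      exact (eq_ind_r L H2 (fill_pred_dynamic args ds)).
    + intros [ds [H1 H2]]. apply E in H1 as [ds' [-> H1]].
      exists ds'. split; [exact H1|].
      exact (eq_ind _ L H2 _ (fill_pred_dynamic args ds')).
  - destruct HQ as [Ha Hb].
    pose proof (proj1 (den_te_iff e HL) _ a Ha) as Ea.
    pose proof (proj1 (den_te_iff e HL) _ b Hb) as Eb.
    destruct s as [s|]; simpl.
    + split; intros [d [H1 H2]]; exists d; split;
        first [apply Ea | apply Eb]; assumption.
    (* An equation between Time-terms: each side denotes the time of its copy, and [eqbX] decides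
       whether these times agree. *)
    + specialize (eqbX_tm (copy a) (copy b)). unfold den_te in Ea, Eb.
      destruct (eqbX (copy a) (copy b)); simpl.
      * split; [intros _ | trivial]. exists (tm (copy a)).
        split; [now apply Ea | now apply Eb, eqbX_tm].
      * split; [easy|]. intros [d [H1 H2]]. apply Ea in H1. apply Eb in H2.
        enough (false = true) by discriminate. apply eqbX_tm. congruence.
  - now rewrite (IH HQ U L).
  - destruct HQ. now rewrite IHf, IHg.
  - destruct HQ. now rewrite IHf, IHg.
  - destruct HQ as [Hs HQ]. destruct s as [s|]; [|now destruct Hs]. simpl.
    split; intros H d; apply (IH HQ L U HL HU (d, e)), H.
  - destruct HQ as [Hs HQ]. destruct s as [s|]; [|now destruct Hs]. simpl.
    split; intros [d H]; exists d; apply (IH HQ L U HL HU (d, e)), H.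
Qed.

(** Satisfaction is Kleene truth with both bounds equal to truth, and truth in J pulled back along
    [timed_atom] is truth in the snapshot. *)
Lemma sat_te G (phi : formula (V := V) G) (e : hlist D (strip G)) :
  time_terms Q phi ->
  sat (A := state) (te_formula eqbX copy phi) e <->
  sat (A := lt_str J) phi (at_time k e).
Proof.
  intros HQ. rewrite <- !ktrue_holds.
  rewrite <- (ktrue_te HQ holds_standard holds_standard).
  split; apply ktrue_mono; intros b; apply holds_timed_atom.
Qed.

Lemma head_te G (h : Defs.head (V := V) G) h' :
  te_head copy h = Some h' -> time_terms_head Q h ->
  forall K, time_standard K -> forall (e : hlist D (strip G)) a,
    head_instance (A := lt_str J) K h (at_time k e) a <->
    exists b, a = timed_atom b /\ head_instance (A := state) (pull K) h' e b.
Proof.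
  intros E HQ K HK e a. destruct h as [p args|f args v]; simpl in *.
  - pose proof (proj2 (den_te_iff e HK) _ args HQ) as Eargs.
    destruct p as [q|q]; injection E as <-; simpl; split.
    + intros [ds [H1 ->]]. apply Eargs in H1 as [ds' [-> H1]].
      exists (@DPred W state (Stat q) ds').
      split; [exact (fill_pred_static args ds')|]. eauto.
    + intros [b [-> [ds' [H1 ->]]]]. exists (fill_time args ds').
      split; [apply Eargs; eauto | exact (eq_sym (fill_pred_static args ds'))].
    + intros [ds [H1 ->]]. apply Eargs in H1 as [ds' [-> H1]].
      exists (@DPred W state (At (copy (time_arg args)) q) ds').
      split; [exact (fill_pred_dynamic args ds')|]. eauto.
    + intros [b [-> [ds' [H1 ->]]]]. exists (fill_time args ds').
      split; [apply Eargs; eauto | exact (eq_sym (fill_pred_dynamic args ds'))].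
  - destruct HQ as [HQ HQv].
    pose proof (proj2 (den_te_iff e HK) _ args HQ) as Eargs.
    pose proof (proj1 (den_te_iff e HK) _ v HQv) as Ev.
    destruct f as [| |g|g]; try discriminate; injection E as <-; simpl; split.
    + intros [ds [d [H1 [H2 ->]]]]. apply Eargs in H1 as [ds' [-> H1]].
      exists (@DFun W state (Stat g) ds' d).
      split; [exact (fill_fun_static args ds' d)|].
      exists ds', d. now apply Ev in H2.
    + intros [b [-> [ds' [d [H1 [H2 ->]]]]]]. exists (fill_time args ds'), d.
      split; [apply Eargs; eauto |]. split; [now apply Ev|].
      exact (eq_sym (fill_fun_static args ds' d)).
    + intros [ds [d [H1 [H2 ->]]]]. apply Eargs in H1 as [ds' [-> H1]].
      exists (@DFun W state (At (copy (time_arg args)) g) ds' d).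
      split; [exact (fill_fun_dynamic args ds' d)|].
      exists ds', d. now apply Ev in H2.
    + intros [b [-> [ds' [d [H1 [H2 ->]]]]]]. exists (fill_time args ds'), d.
      split; [apply Eargs; eauto |]. split; [now apply Ev|].
      exact (eq_sym (fill_fun_dynamic args ds' d)).
Qed.

Lemma te_rule_hsym (r : rule V) r' :
  te_rule eqbX copy r = Some r' -> hsym (rhead r) = lt_sym (hsym (rhead r')).
Proof.
  unfold te_rule. destruct (te_head copy (rhead r)) as [h'|] eqn:E;
    intros H; [injection H as <-|discriminate]. simpl.
  destruct (rhead r) as [[q|q] args|[| |g|g] args v]; simpl in *;
    try discriminate; now injection E as <-.
Qed.

Lemma te_rule_defined (r : rule V) :
  defines_lt_symbol r -> exists r', te_rule eqbX copy r = Some r'.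
Proof.
  unfold te_rule, defines_lt_symbol.
  destruct (rhead r) as [[q|q] args|[| |g|g] args v]; simpl; intros [H1 H2];
    eauto; congruence.
Qed.

Lemma rule_instance_te (r : rule V) r' :
  te_rule eqbX copy r = Some r' -> time_terms_rule Q r ->
  forall L U, time_standard L -> time_standard U ->
  (forall e b, rule_instance (A := state) (pull L) (pull U) (r := r') e b ->
     exists e0 : hlist D (strip (rctx r)),
       rule_instance (A := lt_str J) L U (r := r) (at_time k e0)
         (timed_atom b)) /\
  (forall (e0 : hlist D (strip (rctx r))) b,
     rule_instance (A := lt_str J) L U (r := r) (at_time k e0) (timed_atom b) ->
     exists e, rule_instance (A := state) (pull L) (pull U) (r := r') e b).
Proof.
  unfold te_rule. destruct (te_head copy (rhead r)) as [h'|] eqn:E;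
    intros H; [injection H as <-|discriminate].
  intros [HQh HQb] L U HL HU. unfold rule_instance; simpl. split.
  - intros e b [H1 H2]. exists e. split.
    + apply (head_te E HQh HL). eauto.
    + apply (ktrue_te HQb HL HU), H2.
  - intros e b [H1 H2]. exists e. split.
    + apply (head_te E HQh HL) in H1 as [c [Ec Hc]].
      (* The head lemma only yields some preimage c of the derived atom; injectivity identifies it
         with b. *)
      apply timed_atom_inj in Ec. now rewrite Ec.
    + apply (ktrue_te HQb HL HU), H2.
Qed.

End States.

(** * The shape of Time-terms *)

Section TimeTermFacts.

Context (S : lt_vocabulary).
Local Notation V := (lt_voc S).
Implicit Types (G : list (ty V)).

(** Only I and S have output type Time. The return clause, trivial at every other type, lets the
    static and dynamic functions vanish without inverting an equation between types. *)
Lemma time_term_cases G (a : time_term G) :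
  (exists x : var G None, a = Var (V := V) x) \/
  a = App (V := V) (FInit : fsym V) tnil \/
  exists b, a = succ_term b.
Proof.
  refine (match a as a0 in term _ s0 return
    match s0 return term (V := V) G s0 -> Prop with
    | None => fun a1 => (exists x : var G None, a1 = Var (V := V) x) \/
        a1 = App (V := V) (FInit : fsym V) tnil \/ exists b, a1 = succ_term b
    | Some _ => fun _ => True
    end a0
  with
  | @Var _ _ s0 x => _
  | App f args => _
  end).
  - destruct s0 as [s0|]; eauto.
  - destruct f as [| |g|g]; simpl; trivial.
    + rewrite (terms_nil_eta args). auto.
    + right; right. exists (terms_hd args).
      rewrite (terms_cons_eta args), (terms_nil_eta (terms_tl args)).
      reflexivity.
Qed.

Context (Q : forall G : list (ty V), time_term G -> Prop).

Lemma ttm_time_term G (a : time_term G) : ttm Q a -> Q a.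
Proof.
  destruct (time_term_cases a) as [[x ->]|[->|[b ->]]]; intros H; apply H.
Qed.

Lemma ttms_time_arg G (l : list (sort S))
    (args : terms (V := V) G (dynamic_args l)) :
  ttms Q args -> Q (time_arg args).
Proof.
  induction l as [|s l IH]; simpl in *; rewrite (terms_cons_eta args).
  - simpl. intros [H _]. exact (ttm_time_term H).
  - intros [_ H]. exact (IH _ H).
Qed.

Lemma time_terms_head_time G (h : Defs.head (V := V) G) a :
  time_terms_head Q h -> head_time h = Some a -> Q a.
Proof.
  destruct h as [[q|q] args|[| |g|g] args v]; simpl; intros H E;
    try discriminate; injection E as <-.
  - exact (ttms_time_arg H).
  - exact (ttms_time_arg (proj1 H)).
Qed.

Lemma te_rule_sym_copy X (eqbX : X -> X -> bool) copy (r : rule V) r' a :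
  te_rule eqbX copy r = Some r' -> head_time (rhead r) = Some a ->
  sym_copy (hsym (rhead r')) = Some (copy _ a).
Proof.
  unfold te_rule. destruct (te_head copy (rhead r)) as [h'|] eqn:E;
    intros H; [injection H as <-|discriminate]. simpl.
  destruct (rhead r) as [[q|q] args|[| |g|g] args v]; simpl in *;
    intros Ha; try discriminate; injection E as <-; now injection Ha as <-.
Qed.

End TimeTermFacts.

(** * Replacing t by S(t) *)

Section Successor.

Context (S : lt_vocabulary).
Local Notation V := (lt_voc S).
Local Notation W := (bs_voc S).
Implicit Types (G : list (ty V)).

(** In a single-state formula every Time-term is t, so a constant choice of copy is adequate. It
    turns the substitution of S(t) into a reading of the same formula with t valued k + 1. *)
Definition copy_next G (a : time_term G) : phase := Nxt.

Lemma time_arg_succ G (l : list (sort S))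
    (args : terms (V := V) G (dynamic_args l)) :
  time_arg (succ_tms args) = succ_tm (time_arg args).
Proof.
  induction l as [|s l IH]; simpl in *; rewrite (terms_cons_eta args).
  - reflexivity.
  - exact (IH _).
Qed.

Lemma copy_bs_succ G (a : time_term G) : is_t a -> copy_bs (succ_tm a) = Nxt.
Proof.
  destruct (time_term_cases a) as [[x ->]|[->|[b ->]]]; simpl; easy.
Qed.

Lemma copy_time_arg_succ G (l : list (sort S))
    (args : terms (V := V) G (dynamic_args l)) :
  ttms (@is_t S) args -> copy_bs (time_arg (succ_tms args)) = Nxt.
Proof.
  intros H. rewrite time_arg_succ. exact (copy_bs_succ (ttms_time_arg H)).
Qed.

(* Time-elimination of phi[S(t)/t] is that of phi, t being read as the next
   state. *)
Lemma te_succ_tm G :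
  (forall s (a : term (V := V) G s), ttm (@is_t S) a ->
     te_tm (@copy_bs S) (succ_tm a) = te_tm copy_next a) /\
  (forall l (args : terms (V := V) G l), ttms (@is_t S) args ->
     te_tms (@copy_bs S) (succ_tms args) = te_tms copy_next args).
Proof.
  apply term_mutind.
  - intros [s|] x _; reflexivity.
  - intros [| |g|g] args IH [_ H]; try reflexivity; specialize (IH H).
    + exact (f_equal (fun z => App (V := W) (Stat g : fsym W) z) IH).
    + exact (f_equal2 (fun x
          (z : terms (V := W) (strip G) (strip (dynamic_args (dfun_args g)))) =>
          App (V := W) (At x g : fsym W) z :
            term (V := W) (strip G) (dfun_res g))
        (copy_time_arg_succ (l := dfun_args g) H) IH).
  - reflexivity.
  - intros [s|] l a IHa args IHargs [Ha Hargs]; simpl.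
    + now rewrite IHa, IHargs.
    + exact (IHargs Hargs).
Qed.

Lemma te_succ_formula G (phi : formula (V := V) G) : time_terms (@is_t S) phi ->
  te_formula eqb_phase (@copy_bs S) (succ_formula phi) =
  te_formula eqb_phase copy_next phi.
Proof.
  induction phi as [G|G|G p args|G s a b|G f IH|G f IHf g IHg|G f IHf g IHg
                   |G s f IH|G s f IH]; simpl; intros H.
  - reflexivity.
  - reflexivity.
  - pose proof (proj2 (te_succ_tm G) _ args H) as E.
    destruct p as [q|q].
    + exact (f_equal (fun z => Atom (V := W) (Stat q : psym W) z) E).
    + exact (f_equal2 (fun x
          (z : terms (V := W) (strip G) (strip (dynamic_args (dpred_args q)))) =>
          Atom (V := W) (At x q : psym W) z)
        (copy_time_arg_succ (l := dpred_args q) H) E).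
  - destruct H as [Ha Hb]. destruct s as [s|].
    + now rewrite (proj1 (te_succ_tm G) _ a Ha), (proj1 (te_succ_tm G) _ b Hb).
    + rewrite !copy_bs_succ; [reflexivity | |].
      * exact (ttm_time_term Hb).
      * exact (ttm_time_term Ha).
  - now rewrite IH.
  - destruct H. now rewrite IHf, IHg.
  - destruct H. now rewrite IHf, IHg.
  - destruct H as [_ H]. destruct s as [s|]; [|exact (IH H)].
    exact (f_equal (All (V := W) (s : ty W)) (IH H)).
  - destruct H as [_ H]. destruct s as [s|]; [|exact (IH H)].
    exact (f_equal (Ex (V := W) (s : ty W)) (IH H)).
Qed.

Lemma te_succ_rule (r : rule V) : time_terms_rule (@is_t S) r ->
  te_bs_rule (succ_rule r) = te_rule eqb_phase copy_next r.
Proof.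
  destruct r as [G h phi]. intros [Hh Hphi].
  unfold te_bs_rule, te_rule. simpl in *.
  rewrite (te_succ_formula Hphi).
  enough (E : te_head (@copy_bs S) (succ_head h) = te_head copy_next h)
    by now rewrite E.
  destruct h as [p args|f args v]; simpl in *.
  - pose proof (proj2 (te_succ_tm G) _ args Hh) as E.
    destruct p as [q|q].
    + exact (f_equal (fun z => Some (HPred (V := W) (Stat q : psym W) z)) E).
    + exact (f_equal2 (fun x
          (z : terms (V := W) (strip G) (strip (dynamic_args (dpred_args q)))) =>
          Some (HPred (V := W) (At x q : psym W) z))
        (copy_time_arg_succ (l := dpred_args q) Hh) E).
  - destruct Hh as [Hh Hv]. pose proof (proj2 (te_succ_tm G) _ args Hh) as E.
    pose proof (proj1 (te_succ_tm G) _ v Hv) as Ev.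
    destruct f as [| |g|g]; try reflexivity.
    + exact (f_equal2 (fun z w => Some (HFun (V := W) (Stat g : fsym W) z w))
        E Ev).
    + exact (f_equal3 (fun x
          (z : terms (V := W) (strip G) (strip (dynamic_args (dfun_args g))))
            (w : term (V := W) (strip G) (dfun_res g)) =>
          Some (HFun (V := W) (At x g : fsym W) z w))
        (copy_time_arg_succ (l := dfun_args g) Hh) E Ev).
Qed.

End Successor.

(** * Replacing I by a fresh Time variable *)

Section Initial.

Context (S : lt_vocabulary).
Local Notation V := (lt_voc S).
Implicit Types (G : list (ty V)).

(** [is_init] excludes Time variables and successors, so the fresh variable is the only Time-term
    left and the result can be eliminated like a single-state expression. *)
Lemma uninit_ttm G :
  (forall s (a : term (V := V) G s), ttm (@is_init S) a ->
     ttm (@is_t S) (uninit_tm a)) /\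
  (forall l (args : terms (V := V) G l), ttms (@is_init S) args ->
     ttms (@is_t S) (uninit_tms args)).
Proof.
  apply term_mutind; simpl.
  - intros [s|] x [H _]; split; easy.
  - intros [| |g|g] args IH [H Hargs]; simpl in *; try easy; auto.
  - trivial.
  - intros s l a IHa args IHargs []. auto.
Qed.

Lemma uninit_time_terms G (phi : formula (V := V) G) :
  time_terms (@is_init S) phi -> time_terms (@is_t S) (uninit_formula phi).
Proof.
  pose proof uninit_ttm as U.
  induction phi as [G|G|G p args|G s a b|G f IH|G f IHf g IHg|G f IHf g IHg
                   |G s f IH|G s f IH]; simpl; intros H; intuition;
    now apply U.
Qed.

Lemma uninit_time_terms_rule (r : rule V) :
  time_terms_rule (@is_init S) r -> time_terms_rule (@is_t S) (uninit_rule r).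
Proof.
  intros [H1 H2]. split; [|now apply uninit_time_terms].
  pose proof (uninit_ttm (rctx r)) as U. simpl.
  destruct (rhead r); simpl in *; intuition; now apply U.
Qed.

Lemma hsym_uninit (r : rule V) :
  hsym (rhead (uninit_rule r)) = hsym (rhead r).
Proof. simpl. now destruct (rhead r). Qed.

Context (J : lt_structure S).
Implicit Types (K L U : datom (lt_str J) -> Prop).

(** The fresh variable is valued 0, which is what I denotes under a standard K. *)
Lemma den_uninit K G (e : hlist (dom (lt_str J)) G) : time_standard K ->
  (forall s (a : term (V := V) G s) d,
     den (A := lt_str J) K (snoc_time 0 e) (uninit_tm a) d <->
     den (A := lt_str J) K e a d) /\
  (forall l (args : terms (V := V) G l) ds,
     dens (A := lt_str J) K (snoc_time 0 e) (uninit_tms args) ds <->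
     dens (A := lt_str J) K e args ds).
Proof.
  intros HK. apply term_mutind.
  - intros s x d. simpl. pose proof (hget_snoc 0 x e) as E.
    now rewrite <- E.
  - intros [| |g|g] args IH d.
    + simpl. pose proof (hget_last 0 e) as E. split.
      * intros H. exists tt. split.
        -- now rewrite (terms_nil_eta args).
        -- apply HK. rewrite <- E. now symmetry.
      * intros [ds [_ H]]. apply HK in H. subst d. exact E.
    + simpl. split; intros [ds [H1 H2]]; exists ds; split; auto; now apply IH.
    + simpl. split; intros [ds [H1 H2]]; exists ds; split; auto; now apply IH.
    + simpl. split; intros [ds [H1 H2]]; exists ds; split; auto; now apply IH.
  - reflexivity.
  - intros s l a IHa args IHargs ds. simpl. now rewrite IHa, IHargs.
Qed.

Lemma ktrue_uninit G (phi : formula (V := V) G) : forall L U,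
  time_standard L -> time_standard U -> forall e,
  ktrue (A := lt_str J) L U (uninit_formula phi) (snoc_time 0 e) <->
  ktrue (A := lt_str J) L U phi e.
Proof.
  induction phi as [G|G|G p args|G s a b|G f IH|G f IHf g IHg|G f IHf g IHg
                   |G s f IH|G s f IH]; simpl; intros L U HL HU e.
  - tauto.
  - tauto.
  - pose proof (proj2 (den_uninit e HL) _ args) as E.
    split; intros [ds [H1 H2]]; exists ds; split; auto; now apply E.
  - pose proof (proj1 (den_uninit e HL) _ a) as Ea.
    pose proof (proj1 (den_uninit e HL) _ b) as Eb.
    split; intros [d [H1 H2]]; exists d; split;
      first [now apply Ea | now apply Eb].
  - now rewrite IH.
  - now rewrite IHf, IHg.
  - now rewrite IHf, IHg.
  - split; intros H d; apply (IH L U HL HU (d, e)), H.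
  - split; intros [d H]; exists d; apply (IH L U HL HU (d, e)), H.
Qed.

Lemma rule_instance_uninit L U (r : rule V) e a :
  time_standard L -> time_standard U ->
  rule_instance (A := lt_str J) L U (r := uninit_rule r) (snoc_time 0 e) a <->
  rule_instance (A := lt_str J) L U (r := r) e a.
Proof.
  intros HL HU. unfold rule_instance. simpl.
  rewrite (ktrue_uninit (rbody r) HL HU e).
  enough (E : head_instance (A := lt_str J) L (uninit_head (rhead r))
    (snoc_time 0 e) a <-> head_instance (A := lt_str J) L (rhead r) e a)
    by now rewrite E.
  destruct (rhead r) as [p args|f args v]; simpl.
  - pose proof (proj2 (den_uninit e HL) _ args) as E.
    split; intros [ds [H1 H2]]; exists ds; split; auto; now apply E.
  - pose proof (proj2 (den_uninit e HL) _ args) as E.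
    pose proof (proj1 (den_uninit e HL) _ v) as Ev.
    split; intros [ds [d [H1 [H2 H3]]]]; exists ds, d; split;
      first [now apply E | split; [now apply Ev | exact H3]].
Qed.

End Initial.

(** * Time points denoted by terms and carried by derived atoms *)

Section Values.

Context (S : lt_vocabulary) (J : lt_structure S).
Local Notation V := (lt_voc S).
Local Notation D := (@ldom S J).
Implicit Types (G : list (ty V)).

Context (K : datom (lt_str J) -> Prop).
Hypothesis HK : time_standard K.

Lemma den_tvar k G (e : hlist D (strip G)) (a : time_term G) d :
  is_tvar a -> den (A := lt_str J) K (at_time k e) a d <-> d = k.
Proof.
  destruct (time_term_cases a) as [[x ->]|[->|[b ->]]]; simpl; try easy.
  intros _. pose proof (hget_at_time k x e) as E. simpl in E. rewrite E.
  split; auto.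
Qed.

Lemma den_succ_tvar k G (e : hlist D (strip G)) (a : time_term G) d :
  is_succ_tvar a ->
  den (A := lt_str J) K (at_time k e) a d <-> d = Datatypes.S k.
Proof.
  destruct (time_term_cases a) as [[x ->]|[->|[b ->]]]; simpl; try easy.
  intros Hb. split.
  - intros [ds [[H1 _] H2]]. apply HK in H2. apply (den_tvar k e _ Hb) in H1.
    rewrite H2. exact (f_equal _ H1).
  - intros ->. exists (k, tt). split; [split; [now apply den_tvar | exact I]|].
    now apply HK.
Qed.

Lemma den_init G e (a : time_term G) d :
  is_init a -> den (A := lt_str J) K e a d -> d = 0.
Proof.
  destruct (time_term_cases a) as [[x ->]|[->|[b ->]]]; simpl; try easy.
  intros _ [ds [_ H]]. now apply HK in H.
Qed.

Lemma dens_last_time G e (l : list (sort S))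
    (args : terms (V := V) G (dynamic_args l)) ds :
  dens (A := lt_str J) K e args ds ->
  den (A := lt_str J) K e (time_arg args) (last_time ds).
Proof.
  induction l as [|s l IH]; simpl in *; rewrite (terms_cons_eta args).
  - now intros [H _].
  - intros [_ H]. exact (IH _ _ H).
Qed.

(** Ties the time of a derived atom to the Time argument of the head; the classification of rule
    instances by time rests on it. *)
Lemma head_instance_time G e (h : Defs.head (V := V) G) a :
  head_instance (A := lt_str J) K h e a ->
  match head_time h with
  | None => atom_time a = None
  | Some b => exists n, atom_time a = Some n /\ den (A := lt_str J) K e b n
  end.
Proof.
  destruct h as [[q|q] args|[| |g|g] args v]; simpl.
  - now intros [ds [_ ->]].
  - intros [ds [H ->]]. eexists. split; [reflexivity|].
    exact (dens_last_time H).
  - now intros [ds [d [_ [_ ->]]]].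
  - now intros [ds [d [_ [_ ->]]]].
  - now intros [ds [d [_ [_ ->]]]].
  - intros [ds [d [H [_ ->]]]]. eexists. split; [reflexivity|].
    exact (dens_last_time H).
Qed.

End Values.

Definition ss_time (k : nat) (x : unit) : nat := k.
Definition bs_time (k : nat) (x : phase) : nat :=
  match x with Cur => k | Nxt => S k end.
(** Only k and k + 1 are times of a copy; [Nxt] at all other points is filler. *)
Definition bs_phase (k n : nat) : phase := if n =? k then Cur else Nxt.

Lemma bs_phaseK k x : bs_phase k (bs_time k x) = x.
Proof.
  unfold bs_phase. destruct x; unfold bs_time.
  - now rewrite Nat.eqb_refl.
  - destruct (Nat.eqb_spec (S k) k) as [E|]; [|reflexivity].
    now apply Nat.neq_succ_diag_l in E.
Qed.

Lemma eqb_phase_time k x y :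
  eqb_phase x y = true <-> bs_time k x = bs_time k y.
Proof.
  split; [now destruct x, y|]. intros E. apply (f_equal (bs_phase k)) in E.
  rewrite !bs_phaseK in E. subst y. now destruct x.
Qed.

Lemma eqb_unit_time k (x y : unit) :
  true = true <-> ss_time k x = ss_time k y.
Proof. easy. Qed.

Section CopyReads.

Context (S : lt_vocabulary) (J : lt_structure S) (X : Type) (tm : X -> nat).
Local Notation V := (lt_voc S).

(** Vacuous, as no Time-term qualifies: static expressions may be eliminated with any choice of
    copies and any k. *)
Lemma reads_no_term copy k : copy_reads J tm copy (@is_no_term S) k.
Proof. intros K _ G a []. Qed.

Lemma reads_t copy k :
  (forall G (a : time_term G), is_tvar a -> tm (copy G a) = k) ->
  copy_reads J tm copy (@is_t S) k.
Proof.
  intros H K HK G a Ha e d. rewrite (H G a Ha). now apply den_tvar.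
Qed.

End CopyReads.

Lemma copy_bs_tvar S (G : list (ty (lt_voc S))) (a : time_term G) :
  is_tvar a -> copy_bs a = Cur.
Proof. now destruct (time_term_cases a) as [[x ->]|[->|[b ->]]]. Qed.

Lemma copy_bs_succ_tvar S (G : list (ty (lt_voc S))) (a : time_term G) :
  is_succ_tvar a -> copy_bs a = Nxt.
Proof. now destruct (time_term_cases a) as [[x ->]|[->|[b ->]]]. Qed.

Section BistateReads.

Context (S : lt_vocabulary) (J : lt_structure S).

Lemma reads_t_ss k : copy_reads J (ss_time k) (@copy_ss S) (@is_t S) k.
Proof. now apply reads_t. Qed.

Lemma reads_t_bs k : copy_reads J (bs_time k) (@copy_bs S) (@is_t S) k.
Proof. apply reads_t. intros G a Ha. now rewrite copy_bs_tvar. Qed.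

Lemma reads_t_next k :
  copy_reads J (bs_time k) (@copy_next S) (@is_t S) (Datatypes.S k).
Proof. now apply reads_t. Qed.

Lemma reads_t_or_succ_t k :
  copy_reads J (bs_time k) (@copy_bs S) (@is_t_or_succ_t S) k.
Proof.
  intros K HK G a [Ha|Ha] e d.
  - rewrite copy_bs_tvar by exact Ha. now apply den_tvar.
  - rewrite copy_bs_succ_tvar by exact Ha. now apply den_succ_tvar.
Qed.

End BistateReads.

(** * Projections of a model *)

Section LtcModel.

Context (S : lt_vocabulary) (T : theory (lt_voc S)) (J : lt_structure S).
Local Notation V := (lt_voc S).
Local Notation D := (@ldom S J).
Local Notation Delta := (definition T).

Hypothesis ltc : ltc_theory T.
Hypothesis model : sat_theory (lt_str J) T.

(** By [defines_lt_symbol], I and S are open, so opening gives them their meaning in J whatever K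
    says. *)
Lemma with_open_standard (K : datom (lt_str J) -> Prop) :
  time_standard (with_open Delta K).
Proof.
  destruct ltc as [_ [_ [Hdef _]]].
  assert (N : forall f : fsym V, f = FInit \/ f = FSucc ->
    ~ defined Delta (inr f)).
  { intros f Hf [r [Hr E]]. destruct (Hdef r Hr) as [H1 H2].
    destruct Hf; subst f; contradiction. }
  split; intros ds d; unfold with_open; simpl;
    [specialize (N FInit (or_introl eq_refl))
    |specialize (N FSucc (or_intror eq_refl))]; intuition.
Qed.

Definition derives_at (a : datom (lt_str J)) (L U : datom (lt_str J) -> Prop)
    (r : rule V) (e : hlist (dom (lt_str J)) (rctx r)) : Prop :=
  rule_instance (A := lt_str J) (with_open Delta L) (with_open Delta U)
    (r := r) e a.

Lemma count_static_rule (r : rule V) :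
  static_rule r \/ initial_rule r -> count_time (rctx r) = 0.
Proof. intros [[H _]|[H _]]; exact H. Qed.

Lemma at_time_rule (r : rule V) (e : hlist (lt_dom D) (rctx r)) :
  count_time (rctx r) = 1 -> exists k (e0 : hlist D (strip (rctx r))),
    e = at_time k e0.
Proof.
  intros H. destruct (at_time_exists H e) as [k0 Hk].
  exists k0, (drop_time e). now symmetry.
Qed.

Lemma single_state_head (r : rule V) :
  Delta r -> single_state_rule r -> head_at_t r.
Proof.
  intros Hr [Hc [Hh _]]. destruct ltc as [_ [_ [_ [strat _]]]].
  destruct (head_time (rhead r)) as [a|] eqn:E.
  - exists a. split; [exact E|].
    exact (time_terms_head_time (Q := @is_t S) Hh E).
  - pose proof (count_static_rule (strat r Hr E)). congruence.
Qed.

Lemma bistate_head (r : rule V) :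
  Delta r -> bistate_rule r -> ~ head_at_t r ->
  exists a, head_time (rhead r) = Some a /\ is_succ_tvar a.
Proof.
  intros Hr [Hc [Hh _]] Hn. destruct ltc as [_ [_ [_ [strat _]]]].
  destruct (head_time (rhead r)) as [a|] eqn:E.
  - exists a. split; [reflexivity|].
    destruct (time_terms_head_time (Q := @is_t_or_succ_t S) Hh E) as [H|H];
      [|exact H].
    destruct Hn. now exists a.
  - pose proof (count_static_rule (strat r Hr E)). congruence.
Qed.

(** A bistate rule with head time t is single-state by stratification. The bistate instances that
    remain have head time S(t), so they derive atoms one step after the value of t. *)
Lemma rule_instance_cases L U (r : rule V) e a :
  Delta r -> @derives_at a L U r e ->
  static_rule r \/
  (initial_rule r /\ (atom_time a = None \/ atom_time a = Some 0)) \/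
  (single_state_rule r /\ exists k (e0 : hlist D (strip (rctx r))),
     e = at_time k e0 /\ atom_time a = Some k) \/
  (bistate_rule r /\ ~ head_at_t r /\
   exists k (e0 : hlist D (strip (rctx r))),
     e = at_time k e0 /\ atom_time a = Some (Datatypes.S k)).
Proof.
  intros Hr [Hi _].
  pose proof (with_open_standard L) as HL.
  pose proof ltc as [_ [class [_ [_ [atT _]]]]].
  apply head_instance_time in Hi.
  assert (single : single_state_rule r ->
    exists k (e0 : hlist D (strip (rctx r))),
     e = at_time k e0 /\ atom_time a = Some k).
  { intros Hs. destruct (at_time_rule e (proj1 Hs)) as [k [e0 ->]].
    destruct (single_state_head Hr Hs) as [t [Et Ht]]. rewrite Et in Hi.
    destruct Hi as [n [Hn Hd]]. exists k, e0. split; [reflexivity|].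
    apply (den_tvar _ k e0 n Ht) in Hd. now subst n. }
  destruct (class r Hr) as [H|[H|[H|H]]].
  - auto.
  - right; left. split; [exact H|]. destruct H as [_ [[Hh _] _]].
    destruct (head_time (rhead r)) as [t|] eqn:Et; [|auto].
    destruct Hi as [n [Hn Hd]]. right.
    pose proof (time_terms_head_time (Q := @is_init S) Hh Et) as Ht.
    apply (den_init HL Ht) in Hd. now subst n.
  - right; right; left. split; [exact H | exact (single H)].
  - destruct (classic (head_at_t r)) as [Ha|Ha].
    { right; right; left. pose proof (atT r Hr Ha) as Hs.
      split; [exact Hs | exact (single Hs)]. }
    right; right; right. split; [exact H|]. split; [exact Ha|].
    destruct (at_time_rule e (proj1 H)) as [k [e0 ->]].
    destruct (bistate_head Hr H Ha) as [t [Et Ht]]. rewrite Et in Hi.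
    destruct Hi as [n [Hn Hd]]. exists k, e0. split; [reflexivity|].
    apply (den_succ_tvar HL k e0 n Ht) in Hd. now subst n.
Qed.

Section View.

Context (X : Type) (tm : X -> nat) (copy_at : nat -> X).
Hypothesis copy_at_tm : forall x, copy_at (tm x) = x.
Context (eqbX : X -> X -> bool).
Hypothesis eqbX_tm : forall x y, eqbX x y = true <-> tm x = tm y.
Context (copy : forall G : list (ty V), time_term G -> X).
Context (Q : forall G : list (ty V), time_term G -> Prop) (k : nat).
Hypothesis reads : copy_reads J tm copy Q k.

Let pull (K : datom (lt_str J) -> Prop) (b : datom (state J tm)) : Prop :=
  K (timed_atom b).

Context (r : rule V) (r' : rule (state_voc S X)).
Hypothesis te_r : te_rule eqbX copy r = Some r'.
Hypothesis terms_r : time_terms_rule Q r.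

Lemma view_sound L U e b :
  rule_instance (A := state J tm) (pull (with_open Delta L))
    (pull (with_open Delta U)) (r := r') e b ->
  exists e0 : hlist D (strip (rctx r)),
    @derives_at (timed_atom b) L U r (at_time k e0).
Proof.
  exact (proj1 (rule_instance_te copy_at_tm eqbX_tm reads te_r terms_r
    (with_open_standard L) (with_open_standard U)) e b).
Qed.

Lemma view_complete L U (e0 : hlist D (strip (rctx r))) b :
  @derives_at (timed_atom b) L U r (at_time k e0) ->
  exists e, rule_instance (A := state J tm) (pull (with_open Delta L))
    (pull (with_open Delta U)) (r := r') e b.
Proof.
  exact (proj2 (rule_instance_te copy_at_tm eqbX_tm reads te_r terms_r
    (with_open_standard L) (with_open_standard U)) e0 b).
Qed.

End View.

Lemma static_rule_at_time k (r : rule V) e :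
  static_rule r -> exists e0 : hlist D (strip (rctx r)),
    e = at_time (D := D) k (l := rctx r) e0.
Proof.
  intros [H _]. exists (drop_time e). symmetry.
  exact (at_drop_time_static k H e).
Qed.

Lemma initial_model :
  sat_theory (state J (ss_time 0)) (initial_theory T).
Proof.
  pose proof ltc as [_ [_ [Hdef _]]].
  assert (copyK : forall x : unit, (fun _ => tt) (ss_time 0 x) = x)
    by now intros [].
  split.
  - intros psi' [psi [Hpsi H]]. pose proof (proj1 model psi Hpsi) as M.
    destruct H as [[H ->]|[[[H _] ->]|[[phi [-> H]] ->]]].
    + apply (sat_te (eqb_unit_time 0)
        (@reads_no_term S J _ _ (@copy_ss S) 0) (G := []) tt H). exact M.
    + apply (sat_te (eqb_unit_time 0) (@reads_t_ss S J 0) (G := [None]) tt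
        (uninit_time_terms H)).
      apply ktrue_holds.
      apply (ktrue_uninit psi (@holds_standard S J) (@holds_standard S J) tt),
        ktrue_holds, M.
    + apply (sat_te (eqb_unit_time 0) (@reads_t_ss S J 0) (G := [None]) tt H).
      exact (M 0).
  - apply (sat_definition_split (A := lt_str J) (Delta := Delta)
      (iota := @timed_atom S J _ (ss_time 0))).
    + apply holds_timed_atom.
    + intros b [r' [[r [Hr H]] E]]. exists r. split; [exact Hr|].
      rewrite dsym_timed_atom, <- E.
      destruct H as [[_ H]|[[_ H]|[_ H]]]; apply eq_sym, te_rule_hsym in H;
        [exact H | | exact H].
      rewrite <- H. symmetry. apply hsym_uninit.
    + intros L U r' e b [r [Hr H]] He. exists r. split; [exact Hr|].
      destruct H as [[[_ H] E]|[[[_ [H _]] E]|[[_ H] E]]].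
      * destruct (view_sound copyK (eqb_unit_time 0)
          (@reads_no_term S J _ _ (@copy_ss S) 0) (eq_sym E) H He) as [e0 He0].
        eexists. exact He0.
      * destruct (view_sound copyK (eqb_unit_time 0)
          (@reads_t_ss S J 0) (eq_sym E) (uninit_time_terms_rule H) He)
          as [e0 He0].
        (* Dropping the fresh variable, valued 0, gives an instance of the original initial rule. *)
        destruct (at_time_snoc (G := rctx r) 0 e0) as [e1 E1].
        unfold derives_at in He0. simpl in He0. rewrite E1 in He0.
        apply (proj1 (rule_instance_uninit e1 _ (with_open_standard L)
          (with_open_standard U))) in He0.
        eexists. exact He0.
      * destruct (view_sound copyK (eqb_unit_time 0)
          (@reads_t_ss S J 0) (eq_sym E) H He) as [e0 He0].
        eexists. exact He0.
    + intros L U b _ [r [Hr [e He]]].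
      pose proof (atom_time_timed_atom b) as Et.
      destruct (rule_instance_cases Hr He) as
        [H|[[H _]|[[H [k [e0 [-> Ek]]]]|[_ [_ [k [e0 [_ Ek]]]]]]]].
      * destruct (te_rule_defined (fun _ _ => true) (@copy_ss S) (Hdef r Hr))
          as [r' E].
        exists r'. split; [exists r; split; [exact Hr|]; left; split; easy|].
        destruct (static_rule_at_time 0 e H) as [e0 ->].
        exact (view_complete copyK (eqb_unit_time 0)
          (@reads_no_term S J _ _ (@copy_ss S) 0) E (proj2 H) He).
      * assert (Hd : defines_lt_symbol (uninit_rule r)).
        { unfold defines_lt_symbol. rewrite hsym_uninit. exact (Hdef r Hr). }
        destruct (te_rule_defined (fun _ _ => true) (@copy_ss S) Hd)
          as [r' E].
        exists r'. split.
        { exists r; split; [exact Hr|]; right; left; split; easy. }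
        apply (view_complete copyK (eqb_unit_time 0)
          (@reads_t_ss S J 0) E (uninit_time_terms_rule (proj1 (proj2 H))))
          with (e0 := drop_time (snoc_time 0 e : hlist (lt_dom D) _)).
        unfold derives_at. simpl.
        pose proof (at_drop_snoc_time 0 (proj1 H) e) as E1.
        rewrite E1. apply (proj2 (rule_instance_uninit e _
          (with_open_standard L) (with_open_standard U))). exact He.
      * destruct (te_rule_defined (fun _ _ => true) (@copy_ss S) (Hdef r Hr))
          as [r' E].
        exists r'. split.
        { exists r; split; [exact Hr|]; right; right; split; easy. }
        assert (k = 0) as ->.
        { rewrite Et in Ek. destruct (sym_copy (dsym b)); [|discriminate].
          now injection Ek as <-. }
        exact (view_complete copyK (eqb_unit_time 0)
          (@reads_t_ss S J 0) E (proj2 H) He).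
      (* An instance with head time S(t) derives an atom at a successor time, but atoms of this
         snapshot have time 0 or none. *)
      * rewrite Et in Ek. destruct (sym_copy (dsym b)); discriminate.
    + apply model.
Qed.

Lemma transition_model k :
  sat_theory (state J (bs_time k)) (transition_theory T).
Proof.
  pose proof ltc as [_ [_ [Hdef [_ [atT uniform]]]]].
  pose proof (bs_phaseK k) as copyK.
  pose proof (eqb_phase_time k) as eqbK.
  split.
  - intros psi' [psi [Hpsi H]]. pose proof (proj1 model psi Hpsi) as M.
    destruct H as [[H ->]|[[[phi [-> H]] [->| ->]]|[[phi [-> H]] ->]]].
    + apply (sat_te eqbK
        (@reads_no_term S J _ _ (@copy_bs S) k) (G := []) tt H). exact M.
    + apply (sat_te eqbK (@reads_t_bs S J k) (G := [None]) tt H).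
      exact (M k).
    + unfold te_bs. simpl.
      pose proof (te_succ_formula H) as E. simpl in E. rewrite E.
      apply (sat_te eqbK (@reads_t_next S J k) (G := [None]) tt H).
      exact (M (Datatypes.S k)).
    + apply (sat_te eqbK (@reads_t_or_succ_t S J k) (G := [None]) tt H).
      exact (M k).
  - apply (sat_definition_split (A := lt_str J) (Delta := Delta)
      (iota := @timed_atom S J _ (bs_time k))).
    + apply holds_timed_atom.
    + intros b [r' [[r [Hr H]] E]]. exists r. split; [exact Hr|].
      rewrite dsym_timed_atom, <- E.
      destruct H as [[_ H]|[[Hs [H|H]]|[_ H]]].
      * exact (te_rule_hsym (eq_sym H)).
      * exact (te_rule_hsym (eq_sym H)).
      * rewrite te_succ_rule in H by exact (proj2 Hs).
        exact (te_rule_hsym (eq_sym H)).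
      * exact (te_rule_hsym (eq_sym H)).
    + intros L U r' e b [r [Hr H]] He. exists r. split; [exact Hr|].
      destruct H as [[[_ H] E]|[[[_ H] [E|E]]|[[_ H] E]]].
      * destruct (view_sound copyK eqbK
          (@reads_no_term S J _ _ (@copy_bs S) k) (eq_sym E) H He) as [e0 He0].
        eexists. exact He0.
      * destruct (view_sound copyK eqbK
          (@reads_t_bs S J k) (eq_sym E) H He) as [e0 He0].
        eexists. exact He0.
      * rewrite te_succ_rule in E by exact H.
        destruct (view_sound copyK eqbK
          (@reads_t_next S J k) (eq_sym E) H He) as [e0 He0].
        eexists. exact He0.
      * destruct (view_sound copyK eqbK
          (@reads_t_or_succ_t S J k) (eq_sym E) H He) as [e0 He0].
        eexists. exact He0.
    + intros L U b [r0' [[r0 [Hr0 H0]] E0]] [r [Hr [e He]]].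
      pose proof (atom_time_timed_atom b) as Et.
      assert (same : hsym (rhead r0) = hsym (rhead r)).
      { transitivity (lt_sym (dsym b)).
        - rewrite <- E0. destruct H0 as [[_ H]|[[Hs [H|H]]|[_ H]]].
          + exact (te_rule_hsym (eq_sym H)).
          + exact (te_rule_hsym (eq_sym H)).
          + rewrite te_succ_rule in H by exact (proj2 Hs).
            exact (te_rule_hsym (eq_sym H)).
          + exact (te_rule_hsym (eq_sym H)).
        - rewrite <- dsym_timed_atom. exact (head_instance_dsym (proj1 He)). }
      destruct (uniform r0 r Hr0 Hr same) as [stat_r at_r].
      destruct (uniform r r0 Hr Hr0 (eq_sym same)) as [stat_r0 at_r0].
      (* [r0] witnesses that the transition theory defines the symbol of b, while r derives b in J.
         A static head or a head at t passes from [r0] to r by uniformity. Otherwise [r0] has head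
         time S(t), and b lies at k + 1: the current copy of a symbol given by initial and S(t)
         rules stays open. *)
      assert (cases : static_rule r0 \/ head_at_t r0 \/
        (count_time (rctx r0) = 1 /\
         atom_time (timed_atom b) = Some (Datatypes.S k))).
      { destruct H0 as [[H _]|[[H _]|[H E]]].
        - auto.
        - right; left. now apply single_state_head.
        - right. destruct (classic (head_at_t r0)) as [Ha|Ha]; [auto|].
          right. split; [exact (proj1 H)|].
          destruct (bistate_head Hr0 H Ha) as [t [Ht1 Ht2]].
          rewrite Et, <- E0, (te_rule_sym_copy (eq_sym E) Ht1). simpl.
          now rewrite copy_bs_succ_tvar. }
      destruct (rule_instance_cases Hr He) as
        [H|[[H Hi]|[[H [k1 [e0 [-> Ek]]]]|[H [Hn [k1 [e0 [-> Ek]]]]]]]].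
      * destruct (te_rule_defined eqb_phase (@copy_bs S) (Hdef r Hr))
          as [r' E].
        exists r'. split; [exists r; split; [exact Hr|]; left; split; easy|].
        destruct (static_rule_at_time k e H) as [e0 ->].
        exact (view_complete copyK eqbK
          (@reads_no_term S J _ _ (@copy_bs S) k) E (proj2 H) He).
      (* The transition theory drops initial rules. Here r would be static, or have a Time variable,
         or derive an atom at k + 1, and each is impossible for an initial rule. *)
      * exfalso. destruct cases as [Hs|[Ha|[_ Ha]]].
        -- exact (proj2 (proj2 H) (stat_r Hs)).
        -- pose proof (proj1 (atT r Hr (at_r Ha))). pose proof (proj1 H).
           congruence.
        -- destruct Hi; congruence.
      (* The copy in b places the instance at k or at k + 1; the first is covered by the rule
         itself, the second by its S(t)-version. *)
      * rewrite Et in Ek. destruct (sym_copy (dsym b)) as [[|]|];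
          [| |discriminate]; injection Ek as <-.
        -- destruct (te_rule_defined eqb_phase (@copy_bs S) (Hdef r Hr))
             as [r' E].
           exists r'. split.
           { exists r; split; [exact Hr|]; right; left; split; auto. }
           exact (view_complete copyK eqbK (@reads_t_bs S J k) E (proj2 H) He).
        -- destruct (te_rule_defined eqb_phase (@copy_next S) (Hdef r Hr))
             as [r' E].
           exists r'. split.
           { exists r; split; [exact Hr|]; right; left; split; [exact H|].
             right. rewrite te_succ_rule by exact (proj2 H). now symmetry. }
           exact (view_complete copyK eqbK (@reads_t_next S J k) E (proj2 H) He).
      * destruct cases as [Hs|[Ha|[_ Ha]]].
        -- pose proof (proj1 (stat_r Hs)). pose proof (proj1 H). congruence.
        -- destruct (Hn (at_r Ha)).
        -- assert (k1 = k) as -> by congruence.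
           destruct (te_rule_defined eqb_phase (@copy_bs S) (Hdef r Hr))
             as [r' E].
           exists r'. split.
           { exists r; split; [exact Hr|]; right; right; split; auto. }
           exact (view_complete copyK eqbK
             (@reads_t_or_succ_t S J k) E (proj2 H) He).
    + apply model.
Qed.

End LtcModel.

Theorem theorem3 (S : lt_vocabulary) (T : theory (lt_voc S))
    (phi : sentence (lt_voc S)) :
  ltc_theory T ->
  universal_single_state phi ->
  entails (initial_theory T) (te_ss phi) ->
  entails (add_sentence (transition_theory T) (te_bs phi))
    (te_bs (succ_formula phi)) ->
  lt_entails T phi.
Proof.
  intros ltc [psi [-> Hpsi]] base step J model n.
  (* Here n is the value of the universally quantified t. *)
  induction n as [|n IH].
  - pose proof (base _ (initial_model ltc model)) as H.
    exact (proj1 (sat_te (eqb_unit_time 0) (@reads_t_ss S J 0)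
      (G := [None]) tt Hpsi) H).
  - destruct (transition_model ltc model n) as [M1 M2].
    assert (H : sat_theory (state J (bs_time n))
      (add_sentence (transition_theory T)
        (te_bs (All (None : ty (lt_voc S)) psi)))).
    { split; [|exact M2]. intros chi [Hchi| ->]; [exact (M1 chi Hchi)|].
      exact (proj2 (sat_te (eqb_phase_time n) (@reads_t_bs S J n)
        (G := [None]) tt Hpsi) IH). }
    apply step in H. unfold te_bs in H. simpl in H.
    (* The conclusion about S(t) becomes the body of the sentence read in the next-state copy, hence
       at time n + 1. *)
    pose proof (te_succ_formula Hpsi) as E. simpl in E. rewrite E in H.
    exact (proj1 (sat_te (eqb_phase_time n) (@reads_t_next S J n)
      (G := [None]) tt Hpsi) H).
Qed.
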